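(* Let $(c_n)_{n\ge 0}$ be a complex sequence and put $f(z)=\sum_{n=0}^{\infty}c_nz^n$. If the series $\sum_{n=0}^{\infty}\frac{n!}{\pi^n}c_n$ is absolutely convergent, then $f$ is absolutely entirely summable (i.e. $f_\sigma(z)=\sum_{n=0}^\infty c_nS_n(z)$ converges absolutely for every $z\in\mathbb{C}$) and the following hold. (a) The first derivative of $f_\sigma$ is $$(f_\sigma)'(z)=\sum_{n=1}^{\infty}nc_nS_{n-1}(z)+\lambda(f),\qquad z\in\mathbb{C},$$ where $\lambda(f)=\sum_{n=0}^{\infty}c_n\mathfrak{b}_n$. More generally, for every integer $m\ge 0$, $$(f_\sigma)^{(m)}(z)=\sum_{n=m}^{\infty}\frac{n!}{(n-m)!}\,c_n\,S_{n-m}(z)+\lambda_m(f),\qquad z\in\mathbb{C},$$ where $\lambda_0(f):=0$ and $\lambda_m(f):=\sum_{n=m-1}^{\infty}\frac{n!}{(n-m+1)!}\,\mathfrak{b}_{n-m+1}\,c_n$ for $m\ge 1$ (so that $\lambda_1(f)=\lambda(f)$). Equivalently, for every integer $m\ge 1$, $$(f_\sigma)^{(m)}(z)=\sum_{n=m-1}^{\infty}\frac{n!}{(n-m+1)!}\,c_n\,B_{n-m+1}(z+1),\qquad z\in\mathbb{C}.$$ (b) The integral formula $$\int f_\sigma(z)\,dz=\sum_{n=0}^{\infty}\frac{c_n}{n+1}S_{n+1}(z)-\mu(f)z+C,\qquad z\in\mathbb{C},$$ holds, where $\mu(f)=\sum_{n=1}^{\infty}\mathfrak{b}_n\frac{c_{n-1}}{n}$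 and $C$ is an arbitrary constant; that is, the primitives of $f_\sigma$ on $\mathbb{C}$ are exactly the functions on the right-hand side.
   Context: $B_n(z)$ denotes the $n$-th Bernoulli polynomial, defined by $\frac{te^{zt}}{e^t-1}=\sum_{n=0}^\infty B_n(z)\frac{t^n}{n!}$ for $|t|<2\pi$. The second Bernoulli numbers are $\mathfrak{b}_n:=B_n(1)$. For $n\ge 0$ and $z\in\mathbb{C}$ put $$S_n(z):=\frac{B_{n+1}(z+1)-\mathfrak{b}_{n+1}}{n+1}.$$ For $f(z)=\sum_{n=0}^\infty c_nz^n$, the analytic summand of $f$ is $f_\sigma(z):=\sum_{n=0}^{\infty}c_nS_n(z)$, defined wherever this series converges. $f$ is called (absolutely) analytically summable at $z$ if this series converges (absolutely) at $z$, and (absolutely) entirely summable if this happens for all $z\in\mathbb{C}$. *)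

(* Defs.v *)
From Stdlib Require Import Reals Factorial ClassicalEpsilon.
From Coquelicot Require Export Coquelicot.

Open Scope C_scope.

(* Componentwise, since Coquelicot has no total sum operator on [C]; it is the
   sum whenever [ex_series u] holds in [C]. *)
Definition CSeries (u : nat -> C) : C :=
  (Series (fun n => Re (u n)), Series (fun n => Im (u n))).

(* The sum over [n >= m] of [u n], and its convergence in [C]. *)
Definition CSeries_from (m : nat) (u : nat -> C) : C :=
  CSeries (fun k => u (m + k)%nat).

Definition ex_Cseries_from (m : nat) (u : nat -> C) : Prop :=
  @ex_series C_AbsRing C_NormedModule (fun k => u (m + k)%nat).

Definition is_C_derive (f : C -> C) (z l : C) : Prop :=
  @is_derive C_AbsRing C_NormedModule f z l.

(* [g] is the [m]-th complex derivative of [f] on the whole plane. *)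
Fixpoint is_C_derive_n (f : C -> C) (m : nat) (g : C -> C) : Prop :=
  match m with
  | O => forall z, f z = g z
  | S m' => exists h, is_C_derive_n f m' h /\ forall z, is_C_derive h z (g z)
  end.

Definition Cexp (z : C) : C :=
  ((exp (Re z) * cos (Im z))%R, (exp (Re z) * sin (Im z))%R).

(* The generating function has a removable singularity at [t = 0]; the
   identity on the punctured disc already determines [B]. *)
Definition bernoulli_generating (B : nat -> C -> C) : Prop :=
  forall z t : C, t <> 0 -> (Cmod t < 2 * PI)%R ->
    @is_series C_AbsRing C_NormedModule
      (fun n => B n z * (t ^ n / INR (fact n)))
      (t * Cexp (z * t) / (Cexp t - 1)).

(* The family of Bernoulli polynomials, as the one singled out by its
   generating function. *)
Definition bernoulli : nat -> C -> C :=
  epsilon (inhabits (fun _ _ => RtoC 0)) bernoulli_generating.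

Definition bernoulli_second (n : nat) : C := bernoulli n 1.

Definition Spoly (n : nat) (z : C) : C :=
  (bernoulli (n + 1) (z + 1) - bernoulli_second (n + 1)) / INR (n + 1).

(* A function [f z = sum c n * z ^ n] is represented by its coefficients [c],
   on which all the notions below depend. *)
Definition absolutely_summable_at (c : nat -> C) (z : C) : Prop :=
  ex_series (fun n => Cmod (c n * Spoly n z)).

Definition absolutely_entirely_summable (c : nat -> C) : Prop :=
  forall z : C, absolutely_summable_at c z.

Definition analytic_summand (c : nat -> C) (z : C) : C :=
  CSeries (fun n => c n * Spoly n z).

Definition lambda_term (c : nat -> C) (n : nat) : C :=
  c n * bernoulli_second n.

Definition lambda (c : nat -> C) : C := CSeries (lambda_term c).

(* The index n - m + 1 is written [n + 1 - m] because [nat] subtraction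
   truncates and [n = m - 1] occurs. *)
Definition lambda_n_term (c : nat -> C) (m n : nat) : C :=
  INR (fact n) / INR (fact (n + 1 - m)) * bernoulli_second (n + 1 - m) * c n.

Definition lambda_n (c : nat -> C) (m : nat) : C :=
  match m with
  | O => 0
  | S _ => CSeries_from (m - 1) (lambda_n_term c m)
  end.

Definition mu_term (c : nat -> C) (n : nat) : C :=
  bernoulli_second n * (c (n - 1)%nat / INR n).

Definition mu (c : nat -> C) : C := CSeries_from 1 (mu_term c).

(* Main.v *)
Require Import Defs.
From Stdlib Require Import Reals Factorial Lra Lia Wf_nat ClassicalEpsilon.
From Coquelicot Require Import Coquelicot.
Open Scope C_scope.

(* The generating function first has to be shown to converge on the whole disc
   of radius [2 pi]. The recursion [tan' = 1 + tan^2] gives nonnegative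
   coefficients whose partial sums stay below [tan] on [[0, pi/2)]; hence the
   series of [tan] converges there, and [x tan x = x cot x - 2 x cot (2 x)]
   yields the series of [x cot x] for [|x| < pi]. Since
   [t / (e^t - 1) = w cot w - t / 2] with [t = 2 i w], uniqueness of power
   series coefficients on the imaginary axis gives the generating function.

   Put [b n z = B_n(z) / n!]. The generating function at [t = pi] shows that
   [b n z * pi^n] is bounded in [n], and [e^((z+h)t) = e^(zt) e^(ht)] gives
   [b n (z + h) = sum_k h^k / k! * b (n - k) z]. So if [sum |d n| / pi^n]
   converges, [sum d n * b n z] is differentiable with derivative
   [sum d (n + 1) * b n z], the Taylor remainder being quadratic in [h]
   uniformly in [n]. All series in the theorem have this form, for shifts of
   [d (n + 1) = n! * c n]. *)

(** * Series and power series in the complex plane *)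

(* [ring] and [field] do not see through Coquelicot's structure projections. *)
Ltac ring_at T := match goal with |- ?p = ?q => change (@eq T p q); ring end.
Ltac field_at T := match goal with |- ?p = ?q => change (@eq T p q); field end.

Definition is_Cseries (u : nat -> C) (l : C) : Prop :=
  @is_series C_AbsRing C_NormedModule u l.

Lemma Re_sum_n (u : nat -> C) (n : nat) :
  Re (@sum_n C_NormedModule u n) = sum_n (fun k => Re (u k)) n.
Proof.
  induction n as [|n IH]; [now rewrite !sum_O|].
  rewrite !sum_Sn, <- IH. reflexivity.
Qed.

Lemma Im_sum_n (u : nat -> C) (n : nat) :
  Im (@sum_n C_NormedModule u n) = sum_n (fun k => Im (u k)) n.
Proof.
  induction n as [|n IH]; [now rewrite !sum_O|].
  rewrite !sum_Sn, <- IH. reflexivity.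
Qed.

(** The uniform structure on [C] is the product one: a ball is a product of two real balls, so both
    directions work coordinate by coordinate. *)
Lemma is_Cseries_components (u : nat -> C) (l : C) :
  is_Cseries u l <->
  is_series (fun n => Re (u n)) (Re l) /\ is_series (fun n => Im (u n)) (Im l).
Proof.
  split.
  - intros H; split; intros P [e He].
    + destruct (H (fun z => P (Re z))) as [N HN].
      { exists e. intros y Hy. apply He. exact (proj1 Hy). }
      exists N. intros n Hn. rewrite <- Re_sum_n. exact (HN n Hn).
    + destruct (H (fun z => P (Im z))) as [N HN].
      { exists e. intros y Hy. apply He. exact (proj2 Hy). }
      exists N. intros n Hn. rewrite <- Im_sum_n. exact (HN n Hn).
  - intros [H1 H2] P [e He].
    destruct (H1 (ball (Re l) e)) as [N1 HN1]; [now exists e|].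
    destruct (H2 (ball (Im l) e)) as [N2 HN2]; [now exists e|].
    exists (max N1 N2). intros n Hn. apply He. split.
    + generalize (HN1 n ltac:(lia)). now rewrite <- Re_sum_n.
    + generalize (HN2 n ltac:(lia)). now rewrite <- Im_sum_n.
Qed.

Lemma is_Cseries_unique (u : nat -> C) (l : C) :
  is_Cseries u l -> CSeries u = l.
Proof.
  intros [H1 H2]%is_Cseries_components. unfold CSeries.
  rewrite (is_series_unique _ _ H1), (is_series_unique _ _ H2).
  now destruct l.
Qed.

Lemma im_le_Cmod (c : C) : (Rabs (Im c) <= Cmod c)%R.
Proof.
  apply Rle_trans with (2 := Rmax_Cmod c). apply Rmax_r.
Qed.

Lemma ex_series_Re (u : nat -> C) :
  ex_series (fun n => Cmod (u n)) -> ex_series (fun n => Rabs (Re (u n))).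
Proof.
  apply (@ex_series_le R_AbsRing R_CompleteNormedModule). intros n.
  change (Rabs (Rabs (Re (u n))) <= Cmod (u n))%R.
  rewrite Rabs_Rabsolu. apply re_le_Cmod.
Qed.

Lemma ex_series_Im (u : nat -> C) :
  ex_series (fun n => Cmod (u n)) -> ex_series (fun n => Rabs (Im (u n))).
Proof.
  apply (@ex_series_le R_AbsRing R_CompleteNormedModule). intros n.
  change (Rabs (Rabs (Im (u n))) <= Cmod (u n))%R.
  rewrite Rabs_Rabsolu. apply im_le_Cmod.
Qed.

(** Absolute convergence passes to both coordinates, so the componentwise [CSeries] is then a
    genuine limit in [C]. *)
Lemma is_CSeries_abs (u : nat -> C) :
  ex_series (fun n => Cmod (u n)) -> is_Cseries u (CSeries u).
Proof.
  intros H. apply is_Cseries_components. split; simpl; apply Series_correct.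
  - apply ex_series_Rabs, ex_series_Re, H.
  - apply ex_series_Rabs, ex_series_Im, H.
Qed.

Lemma Cmod_sum_n_le (u : nat -> C) (n : nat) :
  (Cmod (@sum_n C_NormedModule u n) <= sum_n (fun k => Cmod (u k)) n)%R.
Proof.
  induction n as [|n IH]; [rewrite !sum_O; apply Rle_refl|].
  rewrite !sum_Sn. eapply Rle_trans; [apply Cmod_triangle|].
  apply Rplus_le_compat_r, IH.
Qed.

Lemma is_Cseries_ext (u v : nat -> C) (l : C) :
  (forall n, u n = v n) -> is_Cseries u l -> is_Cseries v l.
Proof. apply is_series_ext. Qed.

Lemma is_Cseries_scal (a : C) (u : nat -> C) (l : C) :
  is_Cseries u l -> is_Cseries (fun n => a * u n) (a * l).
Proof. exact (@is_series_scal C_AbsRing C_NormedModule a u l). Qed.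

Lemma is_Cseries_minus (u v : nat -> C) (l m : C) :
  is_Cseries u l -> is_Cseries v m -> is_Cseries (fun n => u n - v n) (l - m).
Proof. exact (@is_series_minus C_AbsRing C_NormedModule u v l m). Qed.

Lemma Cmod_is_Cseries_le (u : nat -> C) (l : C) (b : nat -> R) (m : R) :
  (forall n, (Cmod (u n) <= b n)%R) -> is_Cseries u l -> is_series b m ->
  (Cmod l <= m)%R.
Proof.
  intros Hub Hu Hb.
  assert (Hn : is_lim_seq (fun n => Cmod (@sum_n C_NormedModule u n)) (Cmod l)).
  { intros P HP.
    apply (filterlim_comp _ _ _ _ _ _ _ _ Hu (@filterlim_norm C_AbsRing C_NormedModule l)).
    exact HP. }
  apply (is_lim_seq_le _ _ (Cmod l) m) with (2 := Hn) (3 := Hb).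
  intros n. eapply Rle_trans; [apply Cmod_sum_n_le|].
  now apply sum_n_m_le.
Qed.

Definition conv (a b : nat -> C) (n : nat) : C :=
  @sum_n C_NormedModule (fun k => a k * b (n - k)%nat) n.

(** Expanding real and imaginary parts reduces the claim to four real Cauchy products, each of
    absolutely convergent series. *)
Lemma is_Cseries_conv (a b : nat -> C) (la lb : C) :
  is_Cseries a la -> is_Cseries b lb ->
  ex_series (fun n => Cmod (a n)) -> ex_series (fun n => Cmod (b n)) ->
  is_Cseries (conv a b) (la * lb).
Proof.
  intros [Ha1 Ha2]%is_Cseries_components [Hb1 Hb2]%is_Cseries_components Ha Hb.
  pose proof (ex_series_Re _ Ha) as Ra. pose proof (ex_series_Im _ Ha) as Ia.
  pose proof (ex_series_Re _ Hb) as Rb. pose proof (ex_series_Im _ Hb) as Ib.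
  apply is_Cseries_components. split.
  - eapply is_series_ext;
      [|exact (is_series_minus _ _ _ _ (is_series_mult _ _ _ _ Ha1 Hb1 Ra Rb)
                 (is_series_mult _ _ _ _ Ha2 Hb2 Ia Ib))].
    intros n. unfold conv. rewrite Re_sum_n, <- !sum_n_Reals.
    (* Only the three upper bounds are generalized; the [n] in [n - k] stays fixed during the
       induction. *)
    generalize n at 2 4 6. intros q.
    induction q as [|q IH]; [now rewrite !sum_O|].
    rewrite !sum_Sn, <- IH, re_mult. unfold plus, opp; simpl. ring.
  - eapply is_series_ext;
      [|exact (is_series_plus _ _ _ _ (is_series_mult _ _ _ _ Ha1 Hb2 Ra Ib)
                 (is_series_mult _ _ _ _ Ha2 Hb1 Ia Rb))].
    intros n. unfold conv. rewrite Im_sum_n, <- !sum_n_Reals.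
    change (plus (?x) ?y) with (x + y)%R.
    rewrite <- (sum_n_plus (G := R_AbelianMonoid)). reflexivity.
Qed.

Lemma is_series_delta {K : AbsRing} {V : NormedModule K} (v : V) :
  is_series (fun n : nat => if n then v else zero) v.
Proof.
  unfold is_series. eapply filterlim_ext; [|apply filterlim_const].
  intros n. induction n as [|n IH]; [now rewrite sum_O|].
  now rewrite sum_Sn, <- IH, plus_zero_r.
Qed.

Lemma is_Cseries_incr_1 (u : nat -> C) (l : C) :
  u O = 0 -> is_Cseries u l -> is_Cseries (fun k => u (S k)) l.
Proof.
  intros H0 Hu. apply (@is_series_incr_1 C_AbsRing C_NormedModule).
  rewrite H0. rewrite (@plus_zero_r C_AbelianMonoid). exact Hu.
Qed.

Lemma conv_mul_pow (a b : nat -> C) (t : C) (n : nat) :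
  conv (fun k => a k * t ^ k) (fun k => b k * t ^ k) n = conv a b n * t ^ n.
Proof.
  unfold conv. rewrite Cmult_comm.
  change (?x = t ^ n * ?y) with (x = @mult C_Ring (t ^ n) y).
  rewrite <- (@sum_n_mult_l C_Ring).
  apply (@sum_n_ext_loc C_AbelianMonoid). intros k Hk.
  replace n with (k + (n - k))%nat at 3 by lia.
  change (@mult C_Ring ?x ?y) with (x * y). rewrite Cpow_add_r.
  change (@eq C (a k * t ^ k * (b (n - k)%nat * t ^ (n - k))) (t ^ k * t ^ (n - k) * (a k * b (n - k)%nat))). ring.
Qed.

Lemma is_Cpseries_conv (a b : nat -> C) (t la lb : C) :
  is_Cseries (fun n => a n * t ^ n) la -> is_Cseries (fun n => b n * t ^ n) lb ->
  ex_series (fun n => Cmod (a n * t ^ n)) ->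
  ex_series (fun n => Cmod (b n * t ^ n)) ->
  is_Cseries (fun n => conv a b n * t ^ n) (la * lb).
Proof.
  intros Ha Hb Ha' Hb'.
  apply is_Cseries_ext with (1 := conv_mul_pow a b t).
  now apply is_Cseries_conv.
Qed.

Lemma is_Cseries_bounded (u : nat -> C) (l : C) :
  is_Cseries u l -> exists M : R, forall n, (Cmod (u n) <= M)%R.
Proof.
  intros [H1 H2]%is_Cseries_components.
  destruct (filterlim_bounded (K := R_AbsRing) (V := R_NormedModule) (fun n => Re (u n))) as [M1 HM1].
  { exists 0%R. apply ex_series_lim_0. eexists; exact H1. }
  destruct (filterlim_bounded (K := R_AbsRing) (V := R_NormedModule) (fun n => Im (u n))) as [M2 HM2].
  { exists 0%R. apply ex_series_lim_0. eexists; exact H2. }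
  exists (sqrt 2 * Rmax M1 M2)%R. intros n.
  eapply Rle_trans; [apply Cmod_2Rmax|].
  apply Rmult_le_compat_l; [apply sqrt_pos|].
  apply Rmax_le_compat; [exact (HM1 n)|exact (HM2 n)].
Qed.

Lemma ex_series_bounded_geom (a : nat -> R) (M q : R) :
  (0 <= q < 1)%R -> (forall n, 0 <= a n <= M * q ^ n)%R -> ex_series a.
Proof.
  intros Hq Ha. apply (@ex_series_le R_AbsRing R_CompleteNormedModule) with (fun n => M * q ^ n)%R.
  - intros n. change (Rabs (a n) <= M * q ^ n)%R. rewrite Rabs_pos_eq; apply Ha.
  - apply (@ex_series_scal R_AbsRing R_NormedModule), ex_series_geom.
    rewrite Rabs_pos_eq; lra.
Qed.

(** Abel's lemma: comparison with the geometric series of ratio [Cmod t / r]. *)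
Lemma ex_series_Cmod_pow (a : nat -> C) (M r : R) (t : C) :
  (forall n, (Cmod (a n) * r ^ n <= M)%R) -> (Cmod t < r)%R ->
  ex_series (fun n => Cmod (a n * t ^ n)).
Proof.
  intros Ha Ht. pose proof (Cmod_ge_0 t) as H0.
  apply (ex_series_bounded_geom _ M (Cmod t / r)).
  - split; [apply Rdiv_le_0_compat; lra|].
    apply Rlt_div_l; lra.
  - intros n. split; [apply Cmod_ge_0|].
    rewrite Cmod_mult, Cmod_pow. unfold Rdiv. rewrite Rpow_mult_distr, pow_inv.
    apply Rle_trans with ((Cmod (a n) * r ^ n) * (Cmod t ^ n * / r ^ n))%R.
    + right. field. apply pow_nonzero; lra.
    + apply Rmult_le_compat_r; [|apply Ha].
      apply Rmult_le_pos; [now apply pow_le|].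
      left. apply Rinv_0_lt_compat, pow_lt; lra.
Qed.

(** Only [x > 0] is assumed, since the generating function lives on a punctured disc; continuity of
    the sum at [0] recovers the constant term. *)
Lemma pseries_coef_0 (a : nat -> R) (r : R) :
  (0 < r)%R ->
  (forall x, (0 < x < r)%R -> is_series (fun n => a n * x ^ n)%R 0%R) ->
  a 0%nat = 0%R.
Proof.
  intros Hr H.
  assert (Hcv : Rbar_lt (Rabs 0) (CV_radius a)).
  { apply Rbar_lt_le_trans with (r / 2)%R; [rewrite Rabs_R0; simpl; lra|].
    apply (proj1 (CV_radius_bounded a)).
    destruct (filterlim_bounded (K := R_AbsRing) (V := R_NormedModule)
      (fun n => a n * (r / 2) ^ n)%R) as [M HM].
    - exists 0%R. apply ex_series_lim_0. eexists. apply H. lra.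
    - exists M. exact HM. }
  rewrite <- (PSeries_0 a).
  (* A sequence inside the interval that tends to [0]; the sum vanishes along it. *)
  set (x := fun n => (r / 2 * (/ 2) ^ n)%R).
  assert (Hx : is_lim_seq x 0%R).
  { replace 0%R with (r / 2 * 0)%R by ring.
    apply (is_lim_seq_scal_l _ (r / 2) 0%R), is_lim_seq_geom.
    rewrite Rabs_pos_eq; lra. }
  pose proof (is_lim_seq_continuous (PSeries a) x 0 (PSeries_continuity a 0 Hcv) Hx) as Hl.
  apply (is_lim_seq_ext _ (fun _ => 0%R)) in Hl.
  - apply is_lim_seq_unique in Hl. rewrite Lim_seq_const in Hl.
    now injection Hl.
  - intros n. apply is_series_unique, H. unfold x.
    assert (0 < (/ 2) ^ n <= 1)%R.
    { split; [apply pow_lt; lra|].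
      rewrite <- (pow1 n). apply pow_incr. lra. }
    split; [apply Rmult_lt_0_compat; lra|nra].
Qed.

(** Once the constant term is known to vanish, dividing by [x] gives the same hypothesis for the
    shifted sequence. *)
Lemma pseries_coef_unique (a : nat -> R) (r : R) :
  (0 < r)%R ->
  (forall x, (0 < x < r)%R -> is_series (fun n => a n * x ^ n)%R 0%R) ->
  forall n, a n = 0%R.
Proof.
  intros Hr H n. revert a H. induction n as [|n IH]; intros a H.
  - now apply (pseries_coef_0 a r).
  - apply (IH (fun n => a (S n))). intros x Hx.
    assert (H0 := pseries_coef_0 a r Hr H).
    apply is_series_ext with (fun n => / x * (a (S n) * x ^ S n))%R.
    { intros k. simpl. field. lra. }
    replace 0%R with (/ x * 0)%R by ring.
    apply (@is_series_scal R_AbsRing R_NormedModule).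
    apply (is_series_incr_1 (fun n => a n * x ^ n)%R).
    rewrite H0, Rmult_0_l. unfold plus; simpl. rewrite Rplus_0_l. now apply H.
Qed.

Lemma Cpseries_coef_unique (a b : nat -> C) (r : R) (f : R -> C) :
  (0 < r)%R ->
  (forall x : R, (0 < x < r)%R -> is_Cseries (fun n => a n * x ^ n) (f x)) ->
  (forall x : R, (0 < x < r)%R -> is_Cseries (fun n => b n * x ^ n) (f x)) ->
  forall n, a n = b n.
Proof.
  intros Hr Ha Hb n.
  assert (H : forall x : R, (0 < x < r)%R ->
    is_Cseries (fun n => (a n - b n) * RtoC (x ^ n)) 0).
  { intros x Hx. replace (RtoC 0) with (f x - f x) by ring.
    apply is_Cseries_ext with (fun n => a n * x ^ n - b n * x ^ n).
    - intros k. rewrite RtoC_pow. ring.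
    - apply is_Cseries_minus; auto. }
  assert (E : a n - b n = 0).
  { assert (E1 : Re (a n - b n) = 0%R).
    { apply (pseries_coef_unique (fun n => Re (a n - b n)) r Hr).
      intros x Hx. destruct (proj1 (is_Cseries_components _ _) (H x Hx)) as [K _].
      eapply is_series_ext; [|exact K]. intros k. simpl. ring. }
    assert (E2 : Im (a n - b n) = 0%R).
    { apply (pseries_coef_unique (fun n => Im (a n - b n)) r Hr).
      intros x Hx. destruct (proj1 (is_Cseries_components _ _) (H x Hx)) as [_ K].
      eapply is_series_ext; [|exact K]. intros k. simpl. ring. }
    destruct (a n - b n) as [p q]. simpl in E1, E2. now subst. }
  replace (a n) with (a n - b n + b n) by ring. rewrite E. ring.
Qed.

(** * The power series of [tan x] and [x cot x] *)

Open Scope R_scope.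

(** [N] is fuel: a coefficient depends on all earlier ones through the Cauchy square, which is not a
    structural recursion on [n]. *)
Fixpoint tan_coef_approx (N n : nat) : R :=
  match N, n with
  | S N', S m => ((if m then 1 else 0)
      + PS_mult (tan_coef_approx N') (tan_coef_approx N') m) / INR (S m)
  | _, _ => 0
  end.

(* The recursion is the differential equation [tan' = 1 + tan^2], read on
   coefficients. *)
Definition tan_coef (n : nat) : R := tan_coef_approx n n.

Lemma tan_coef_approx_stable (N n : nat) :
  (n <= N)%nat -> tan_coef_approx N n = tan_coef n.
Proof.
  unfold tan_coef. revert N. induction n as [n IH] using lt_wf_ind. intros N HN.
  destruct n as [|m]; [now destruct N|]. destruct N as [|N]; [lia|].
  simpl tan_coef_approx at 1 2. do 2 f_equal. unfold PS_mult.
  apply sum_eq. intros k Hk.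
  rewrite (IH k ltac:(lia) N ltac:(lia)), (IH k ltac:(lia) m ltac:(lia)).
  now rewrite (IH (m - k)%nat ltac:(lia) N ltac:(lia)),
    (IH (m - k)%nat ltac:(lia) m ltac:(lia)).
Qed.

Lemma tan_coef_0 : tan_coef 0 = 0.
Proof. reflexivity. Qed.

Lemma tan_coef_S (n : nat) :
  PS_derive tan_coef n = (if n then 1 else 0) + PS_mult tan_coef tan_coef n.
Proof.
  unfold PS_derive. unfold tan_coef at 1. cbn [tan_coef_approx].
  replace (PS_mult (tan_coef_approx n) (tan_coef_approx n) n)
    with (PS_mult tan_coef tan_coef n).
  - field. apply not_0_INR. lia.
  - apply sum_eq. intros k Hk. now rewrite !tan_coef_approx_stable by lia.
Qed.

Lemma tan_coef_nonneg (n : nat) : 0 <= tan_coef n.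
Proof.
  unfold tan_coef. generalize n at 1. intros N. revert n.
  induction N as [|N IH]; intros [|n]; try apply Rle_refl.
  cbn [tan_coef_approx]. apply Rdiv_le_0_compat; [|apply lt_0_INR; lia].
  apply Rplus_le_le_0_compat; [destruct n; lra|].
  apply cond_pos_sum. intros k. now apply Rmult_le_pos.
Qed.

(** The square of the partial sum contains the truncated Cauchy square, and the remaining products
    are nonnegative. *)
Lemma sum_conv_le_mult (a : nat -> R) (N : nat) :
  (forall n, 0 <= a n) ->
  sum_f_R0 (fun n => sum_f_R0 (fun k => a k * a (n - k)%nat) n) N
    <= sum_f_R0 a N * sum_f_R0 a N.
Proof.
  intros Ha. destruct N as [|N]; [simpl; lra|].
  rewrite (cauchy_finite a a (S N)) by lia.
  rewrite <- (Rplus_0_r (sum_f_R0 _ (S N))) at 1. apply Rplus_le_compat_l.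
  apply cond_pos_sum. intros n. apply cond_pos_sum. intros k.
  now apply Rmult_le_pos.
Qed.

Lemma PS_mult_mul_pow (a b : nat -> R) (x : R) (n : nat) :
  sum_f_R0 (fun k => a k * x ^ k * (b (n - k)%nat * x ^ (n - k))) n
    = PS_mult a b n * x ^ n.
Proof.
  unfold PS_mult. rewrite Rmult_comm, scal_sum. apply sum_eq. intros k Hk.
  replace (x ^ n) with (x ^ k * x ^ (n - k)); [ring|].
  rewrite <- pow_add. f_equal. lia.
Qed.

(* Comparison of the differential inequality
   [s_(N+1)' <= 1 + s_N^2] with [tan' = 1 + tan^2]. *)
Lemma tan_coef_partial_sum_le (N : nat) (x : R) :
  0 <= x < PI / 2 -> sum_f_R0 (fun k => tan_coef k * x ^ k) N <= tan x.
Proof.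
  revert x. induction N as [|N IH]; intros x Hx.
  { simpl. rewrite tan_coef_0, Rmult_0_l. destruct (Req_dec x 0) as [->|H].
    - rewrite tan_0. lra.
    - left. apply tan_gt_0; lra. }
  set (s := fun M y => sum_f_R0 (fun k => tan_coef k * y ^ k) M).
  change (s (S N) x <= tan x).
  set (ds := fun y => sum_f_R0 (fun k => PS_derive tan_coef k * y ^ k) N).
  assert (Hd : forall y, 0 <= y <= x ->
    is_derive (fun y => tan y - s (S N) y) y (tan y ^ 2 + 1 - ds y)).
  { intros y Hy. apply (@is_derive_minus R_AbsRing R_NormedModule tan (s (S N))).
    - apply is_derive_tan. apply Rgt_not_eq, cos_gt_0; lra.
    - apply is_derive_Reals. exact (derivable_pt_lim_finite_sum tan_coef y (S N)). }
  (* The derivative [ds] is [1] plus the truncated Cauchy square, hence at most [1 + s N y * s N y];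
     the induction hypothesis gives [0 <= s N y <= tan y]. *)
  assert (Hpos : forall y, 0 <= y <= x -> 0 <= tan y ^ 2 + 1 - ds y).
  { intros y Hy.
    assert (E : ds y = 1 + sum_f_R0 (fun n => sum_f_R0 (fun k =>
      tan_coef k * y ^ k * (tan_coef (n - k) * y ^ (n - k))) n) N).
    { unfold ds. rewrite (sum_eq _ (fun n => (if n then 1 else 0) +
        sum_f_R0 (fun k => tan_coef k * y ^ k * (tan_coef (n - k) * y ^ (n - k))) n)).
      - rewrite plus_sum. f_equal. clear.
        induction N as [|N IH]; [reflexivity|]. rewrite tech5, IH. ring.
      - intros k _. rewrite tan_coef_S, PS_mult_mul_pow. destruct k; simpl; ring. }
    assert (Hs0 : 0 <= s N y).
    { apply cond_pos_sum. intros k. apply Rmult_le_pos; [apply tan_coef_nonneg|].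
      apply pow_le; lra. }
    assert (H1 := sum_conv_le_mult (fun k => tan_coef k * y ^ k) N).
    assert (H2 := IH y ltac:(lra)). fold (s N y) in H2.
    cbv beta in H1. change (sum_f_R0 (fun k => tan_coef k * y ^ k) N) with (s N y) in H1.
    rewrite E. enough (s N y * s N y <= tan y ^ 2).
    { specialize (H1 (fun k => Rmult_le_pos _ _ (tan_coef_nonneg k)
        (pow_le y k ltac:(lra)))). lra. }
    simpl. nra. }
  (* [tan - s (S N)] vanishes at [0] and has nonnegative derivative, so it is nonnegative at [x]. *)
  destruct (MVT_gen (fun y => tan y - s (S N) y) 0 x
    (fun y => tan y ^ 2 + 1 - ds y)) as (c & Hc & E).
  - intros y. rewrite Rmin_left, Rmax_right by lra. intros Hy. apply Hd. lra.
  - intros y. rewrite Rmin_left, Rmax_right by lra. intros Hy.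
    apply continuity_pt_filterlim.
    apply (@ex_derive_continuous R_AbsRing R_NormedModule
      (fun y => tan y - s (S N) y)).
    eexists. apply (Hd y). lra.
  - rewrite Rmin_left, Rmax_right in Hc by lra.
    assert (E0 : s (S N) 0 = 0).
    { unfold s. clear. induction (S N) as [|M IH].
      - simpl. rewrite tan_coef_0. ring.
      - rewrite tech5, IH. simpl. ring. }
    rewrite tan_0, E0 in E. specialize (Hpos c Hc).
    assert (0 <= (tan c ^ 2 + 1 - ds c) * (x - 0)) by (apply Rmult_le_pos; lra).
    lra.
Qed.

Lemma tan_coef_pow_le (n : nat) (x : R) :
  0 <= x < PI / 2 -> tan_coef n * x ^ n <= tan x.
Proof.
  intros Hx. eapply Rle_trans; [|apply (tan_coef_partial_sum_le n x Hx)].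
  assert (H : forall k, 0 <= tan_coef k * x ^ k).
  { intros k. apply Rmult_le_pos; [apply tan_coef_nonneg|apply pow_le; lra]. }
  destruct n as [|n]; [apply Rle_refl|]. rewrite tech5.
  rewrite <- (Rplus_0_l (tan_coef (S n) * x ^ S n)) at 1.
  apply Rplus_le_compat_r. now apply cond_pos_sum.
Qed.

(** At the midpoint of [Rabs x] and [PI / 2] the terms are bounded by the value of [tan] there, so
    the radius is at least that midpoint. *)
Lemma tan_coef_CV_radius (x : R) :
  Rabs x < PI / 2 -> Rbar_lt (Rabs x) (CV_radius tan_coef).
Proof.
  intros Hx. pose proof (Rabs_pos x).
  apply Rbar_lt_le_trans with ((Rabs x + PI / 2) / 2); [simpl; lra|].
  apply (proj1 (CV_radius_bounded tan_coef)).
  exists (tan ((Rabs x + PI / 2) / 2)). intros n. rewrite Rabs_pos_eq.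
  - apply tan_coef_pow_le. lra.
  - apply Rmult_le_pos; [apply tan_coef_nonneg|apply pow_le; lra].
Qed.

(* Both [atan T] and the identity have derivative [1], where [T] is the sum of
   the series. *)
Lemma is_series_tan_coef (x : R) :
  0 <= x < PI / 2 -> is_series (fun n => tan_coef n * x ^ n) (tan x).
Proof.
  intros Hx. set (T := PSeries tan_coef).
  assert (Hcv : forall y, 0 <= y <= x -> Rbar_lt (Rabs y) (CV_radius tan_coef)).
  { intros y Hy. apply tan_coef_CV_radius. rewrite Rabs_pos_eq; lra. }
  assert (HT : forall y, 0 <= y <= x -> is_derive T y (1 + T y ^ 2)).
  { intros y Hy. specialize (Hcv y Hy).
    replace (1 + T y ^ 2) with (PSeries (PS_derive tan_coef) y);
      [now apply is_derive_PSeries|].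
    rewrite (PSeries_ext _ (PS_plus (fun n => if n then 1 else 0)
      (PS_mult tan_coef tan_coef)) y tan_coef_S).
    assert (H1 : is_pseries (fun n : nat => if n then 1 else 0) y 1).
    { apply is_pseries_R. eapply is_series_ext; [|apply (is_series_delta 1)].
      intros [|n]; unfold zero; simpl; ring. }
    rewrite PSeries_plus.
    - rewrite (is_pseries_unique _ _ _ H1), PSeries_mult by easy. unfold T. ring.
    - now exists 1.
    - now apply ex_pseries_mult. }
  assert (E : atan (T x) - x = 0).
  { destruct (MVT_gen (fun y => atan (T y) - y) 0 x (fun _ => 0)) as (c & Hc & E).
    - intros y. rewrite Rmin_left, Rmax_right by lra. intros Hy.
      replace 0 with (minus ((1 + T y ^ 2) * / (1 + (T y)²)) 1)%R.
      + apply (@is_derive_minus R_AbsRing R_NormedModule _ (fun y => y)).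
        * apply (@is_derive_comp R_AbsRing R_NormedModule atan T).
          -- apply is_derive_atan.
          -- apply HT. lra.
        * apply (@is_derive_id R_AbsRing).
      + unfold minus, plus, opp, Rsqr; simpl. field.
        generalize (Rle_0_sqr (T y)). unfold Rsqr. intros; nra.
    - intros y. rewrite Rmin_left, Rmax_right by lra. intros Hy.
      apply continuity_pt_filterlim.
      apply (@ex_derive_continuous R_AbsRing R_NormedModule (fun y => atan (T y) - y)).
      apply (@ex_derive_minus R_AbsRing R_NormedModule _ (fun y => y)).
      + apply ex_derive_comp; eexists; [apply is_derive_atan|apply HT; lra].
      + apply ex_derive_id.
    - unfold T in E at 2. rewrite PSeries_0, tan_coef_0, atan_0 in E. lra. }
  replace (tan x) with (T x).
  - apply is_pseries_R, PSeries_correct, CV_disk_correct, CV_disk_inside, Hcv. lra.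
  - replace x with (atan (T x)) at 2 by lra. symmetry. apply tan_atan.
Qed.

(* [cot x - 2 cot (2x) = tan x] determines the coefficients of [x cot x]. *)
Definition xcot_coef (n : nat) : R :=
  match n with
  | O => 1
  | S m => - tan_coef m / (2 ^ S m - 1)
  end.

(** The denominator [2 ^ S m - 1] is at least [2 ^ m], which doubles the range of the tangent bound
    from [PI / 2] to [PI]. *)
Lemma xcot_coef_bounded (r : R) :
  0 <= r < PI -> exists M, forall n, Rabs (xcot_coef n) * r ^ n <= M.
Proof.
  intros Hr. exists (1 + tan (r / 2) * r).
  assert (Hm : forall m, 0 <= tan_coef m * (r / 2) ^ m <= tan (r / 2)).
  { intros m. split; [|apply tan_coef_pow_le; lra].
    apply Rmult_le_pos; [apply tan_coef_nonneg|apply pow_le; lra]. }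
  assert (Ht : 0 <= tan (r / 2) * r) by (specialize (Hm 0%nat); nra).
  intros [|m]; simpl xcot_coef.
  - rewrite Rabs_R1. simpl. lra.
  - assert (H2 : 1 <= 2 ^ m) by (apply pow_R1_Rle; lra).
    assert (H3 := tan_coef_nonneg m). specialize (Hm m).
    assert (H4 : 0 < 2 ^ S m - 1) by (simpl; lra).
    rewrite Rabs_div, Rabs_Ropp, !Rabs_pos_eq by lra.
    apply Rle_trans with (tan_coef m / 2 ^ m * r ^ S m).
    + apply Rmult_le_compat_r; [apply pow_le; lra|].
      apply Rmult_le_compat_l; [lra|].
      apply Rinv_le_contravar; simpl; lra.
    + replace (tan_coef m / 2 ^ m * r ^ S m) with (tan_coef m * (r / 2) ^ m * r).
      * nra.
      * unfold Rdiv. rewrite Rpow_mult_distr, pow_inv. simpl. field. lra.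
Qed.

Lemma xcot_coef_CV_radius (x : R) :
  Rabs x < PI -> Rbar_lt (Rabs x) (CV_radius xcot_coef).
Proof.
  intros Hx. pose proof (Rabs_pos x).
  apply Rbar_lt_le_trans with ((Rabs x + PI) / 2); [simpl; lra|].
  apply (proj1 (CV_radius_bounded xcot_coef)).
  destruct (xcot_coef_bounded ((Rabs x + PI) / 2)) as [M HM]; [lra|].
  exists M. intros n. rewrite Rabs_mult, (Rabs_pos_eq (_ ^ n)); [apply HM|].
  apply pow_le. lra.
Qed.

Lemma is_series_xcot_coef (x : R) :
  Rabs x < PI -> is_series (fun n => xcot_coef n * x ^ n) (PSeries xcot_coef x).
Proof.
  intros Hx. apply is_pseries_R, PSeries_correct, CV_disk_correct, CV_disk_inside.
  now apply xcot_coef_CV_radius.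
Qed.

(** Constant terms cancel, and in degree [S n] the factor [1 - 2 ^ S n] removes the denominator of
    [xcot_coef], leaving [x] times the tangent series. *)
Lemma PSeries_xcot_double (x : R) :
  0 < x < PI / 2 ->
  PSeries xcot_coef x - PSeries xcot_coef (2 * x) = x * tan x.
Proof.
  intros Hx.
  assert (H : is_series (fun n => xcot_coef n * x ^ n - xcot_coef n * (2 * x) ^ n)
    (PSeries xcot_coef x - PSeries xcot_coef (2 * x))).
  { apply (@is_series_minus R_AbsRing R_NormedModule);
      apply is_series_xcot_coef; rewrite Rabs_pos_eq; lra. }
  rewrite <- (is_series_unique _ _ H). apply is_series_unique.
  apply (@is_series_decr_1 R_AbsRing R_NormedModule).
  replace (plus _ _) with (x * tan x) by (unfold plus, opp; simpl; ring).
  eapply is_series_ext;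
    [|exact (@is_series_scal R_AbsRing R_NormedModule x _ _
       (is_series_tan_coef x ltac:(lra)))].
  intros n. change (scal ?a ?b) with (a * b).
  rewrite Rpow_mult_distr. simpl.
  assert (1 <= 2 ^ n) by (apply pow_R1_Rle; lra). field. lra.
Qed.

(** The difference [D] between the series and [x cot x] is unchanged when its argument is halved.
    Along [x / 2 ^ n] both functions tend to [1], so [D x = 0]. *)
Lemma PSeries_xcot (x : R) :
  0 < x < PI -> PSeries xcot_coef x * sin x = x * cos x.
Proof.
  (* [y cot y] is written with [sin y / y] so that its limit at [0] follows from that of the
     cardinal sine. *)
  intros Hx. set (Q := fun y => cos y / (sin y / y)).
  set (D := fun y => PSeries xcot_coef y - Q y).
  assert (HD : forall y, 0 < y < PI / 2 -> D (2 * y) = D y).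
  { intros y Hy. unfold D, Q. pose proof (PSeries_xcot_double y Hy) as E.
    assert (0 < sin y) by (apply sin_gt_0; lra).
    assert (0 < cos y) by (apply cos_gt_0; lra).
    replace (PSeries xcot_coef (2 * y)) with (PSeries xcot_coef y - y * tan y) by lra.
    rewrite sin_2a, cos_2a. unfold tan. field. lra. }
  set (u := fun n => x * (/ 2) ^ n).
  assert (Hu0 : forall n, 0 < u n <= x).
  { intros n. unfold u.
    assert (0 < (/ 2) ^ n <= 1).
    { split; [apply pow_lt; lra|]. rewrite <- (pow1 n). apply pow_incr. lra. }
    nra. }
  assert (HDu : forall n, D (u n) = D x).
  { induction n as [|n IH]; [unfold u; now rewrite pow_O, Rmult_1_r|].
    assert (E : 2 * u (S n) = u n) by (unfold u; simpl; field).
    rewrite <- IH, <- E. symmetry. apply HD.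
    pose proof (Hu0 n). pose proof (Hu0 (S n)). lra. }
  assert (Hu : is_lim_seq u 0).
  { replace 0 with (x * 0) by ring.
    apply (is_lim_seq_scal_l _ x 0), is_lim_seq_geom. rewrite Rabs_pos_eq; lra. }
  assert (H1 : is_lim_seq (fun n => PSeries xcot_coef (u n)) 1).
  { replace 1 with (PSeries xcot_coef 0) by apply PSeries_0.
    apply is_lim_seq_continuous; [|exact Hu].
    apply PSeries_continuity, xcot_coef_CV_radius. rewrite Rabs_R0. lra. }
  assert (H2 : is_lim_seq (fun n => sin (u n) / u n) 1).
  { apply (is_lim_comp_seq (fun y => sin y / y) u 0 1 is_lim_sinc_0); [|exact Hu].
    exists 0%nat. intros n _ E. injection E. generalize (Hu0 n). lra. }
  assert (H3 : is_lim_seq (fun n => cos (u n)) 1).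
  { rewrite <- cos_0. apply is_lim_seq_continuous; [|exact Hu].
    apply derivable_continuous_pt, derivable_pt_cos. }
  assert (H4 : is_lim_seq (fun n => D (u n)) (1 - 1 / 1)).
  { apply is_lim_seq_minus'; [exact H1|]. apply is_lim_seq_div'; [exact H3|exact H2|lra]. }
  apply (is_lim_seq_ext _ (fun _ => D x)) in H4; [|exact HDu].
  apply is_lim_seq_unique in H4. rewrite Lim_seq_const in H4. injection H4 as H4.
  unfold D, Q in H4.
  assert (Hs : 0 < sin x) by (apply sin_gt_0; lra).
  replace (PSeries xcot_coef x) with (cos x / (sin x / x)) by lra.
  field. lra.
Qed.

Open Scope C_scope.

(** * The exponential series *)

(** Read both as the terms of the series of [e^a] and as the coefficients in [t] of [e^(at)]. *)
Definition exp_coef (a : C) (n : nat) : C := a ^ n / INR (fact n).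

Lemma RtoC_fact_neq_0 (n : nat) : RtoC (INR (fact n)) <> 0.
Proof. intros H. injection H. apply INR_fact_neq_0. Qed.

Lemma RtoC_INR_S_neq_0 (n : nat) : RtoC (INR (S n)) <> 0.
Proof. intros H. apply (f_equal Re), not_0_INR in H; [easy|lia]. Qed.

Lemma exp_coef_S (a : C) (n : nat) :
  INR (S n) * exp_coef a (S n) = a * exp_coef a n.
Proof.
  unfold exp_coef. rewrite Cpow_S, fact_simpl, mult_INR, RtoC_mult. field.
  split; [apply RtoC_fact_neq_0|apply RtoC_INR_S_neq_0].
Qed.

Lemma sum_n_Sl (u : nat -> C) (n : nat) :
  @sum_n C_NormedModule u (S n) = u O + @sum_n C_NormedModule (fun k => u (S k)) n.
Proof.
  unfold sum_n. rewrite (@sum_Sn_m C_NormedModule) by lia.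
  now rewrite <- (@sum_n_m_S C_NormedModule).
Qed.

(** The binomial theorem divided by [n!], by induction: multiplying by [S n = k + (S n - k)] splits
    the sum into two, and [exp_coef_S] extracts [a] from one and [b] from the other. *)
Lemma conv_exp_coef (a b : C) (n : nat) :
  conv (exp_coef a) (exp_coef b) n = exp_coef (a + b) n.
Proof.
  induction n as [|n IH].
  { unfold conv, exp_coef. rewrite sum_O. simpl. change (1 / 1 * (1 / 1) = 1 / 1). field. }
  enough (E : INR (S n) * conv (exp_coef a) (exp_coef b) (S n)
    = INR (S n) * exp_coef (a + b) (S n)).
  { apply (f_equal (fun z => / INR (S n) * z)) in E.
    rewrite !Cmult_assoc, Cinv_l, !Cmult_1_l in E by apply RtoC_INR_S_neq_0. exact E. }
  rewrite exp_coef_S, <- IH.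
  set (u := fun k => INR k * exp_coef a k * exp_coef b (S n - k)).
  set (v := fun k => exp_coef a k * (INR (S n - k) * exp_coef b (S n - k))).
  transitivity (@sum_n C_NormedModule u (S n) + @sum_n C_NormedModule v (S n)).
  - unfold conv.
    etransitivity; [|exact (@sum_n_plus C_AbelianMonoid u v (S n))].
    change (INR (S n) * ?y) with (@mult C_Ring (RtoC (INR (S n))) y).
    rewrite <- (@sum_n_mult_l C_Ring).
    apply (@sum_n_ext_loc C_AbelianMonoid). intros k Hk. unfold u, v.
    replace (RtoC (INR (S n))) with (INR k + INR (S n - k)).
    + change (@eq C ((INR k + INR (S n - k)) * (exp_coef a k * exp_coef b (S n - k)))
        (INR k * exp_coef a k * exp_coef b (S n - k)
         + exp_coef a k * (INR (S n - k) * exp_coef b (S n - k)))). ring.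
    + rewrite <- RtoC_plus, <- plus_INR. do 3 f_equal. lia.
  - rewrite Cmult_plus_distr_r. f_equal.
    (* The term [k = 0] of [u] vanishes, and so below does the last term of [v]; both sums become
       the convolution of order [n]. *)
    + rewrite sum_n_Sl. unfold u at 1. simpl INR. rewrite !Cmult_0_l, Cplus_0_l.
      unfold conv. change (a * ?y) with (@mult C_Ring a y).
      rewrite <- (@sum_n_mult_l C_Ring).
      apply (@sum_n_ext C_AbelianMonoid). intros k. unfold u.
      rewrite exp_coef_S. symmetry. apply Cmult_assoc.
    + rewrite sum_Sn. unfold v at 2. rewrite Nat.sub_diag. simpl INR at 1.
      rewrite Cmult_0_l, Cmult_0_r.
      etransitivity; [exact (Cplus_0_r _)|].
      unfold conv. change (b * ?y) with (@mult C_Ring b y).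
      rewrite <- (@sum_n_mult_l C_Ring).
      apply (@sum_n_ext_loc C_AbelianMonoid). intros k Hk. unfold v.
      rewrite Nat.sub_succ_l, exp_coef_S by easy.
      change (@eq C (exp_coef a k * (b * exp_coef b (n - k)))
        (b * (exp_coef a k * exp_coef b (n - k)))). ring.
Qed.

Lemma is_series_exp (x : R) :
  is_series (fun n => x ^ n / INR (fact n))%R (exp x).
Proof.
  eapply is_series_ext; [|exact (proj1 (is_pseries_R _ _ _) (is_exp_Reals x))].
  intros n. simpl. unfold Rdiv. ring.
Qed.

Lemma Cmod_exp_coef (a : C) (n : nat) :
  Cmod (exp_coef a n) = (Cmod a ^ n / INR (fact n))%R.
Proof.
  unfold exp_coef. rewrite Cmod_div, Cmod_pow, Cmod_R, Rabs_pos_eq;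
    [reflexivity|apply pos_INR|apply RtoC_fact_neq_0].
Qed.

Lemma ex_series_exp_coef (a : C) : ex_series (fun n => Cmod (exp_coef a n)).
Proof.
  apply ex_series_ext with (1 := fun n => eq_sym (Cmod_exp_coef a n)).
  eexists. apply is_series_exp.
Qed.

Lemma Ci_pow_even (n : nat) : Ci ^ (2 * n) = ((-1) ^ n)%R.
Proof.
  rewrite Cpow_mult_r, RtoC_pow. f_equal. simpl. unfold Ci, Cmult, RtoC; simpl.
  f_equal; ring.
Qed.

Lemma Ci_pow_odd (n : nat) : Ci ^ (2 * n + 1) = ((-1) ^ n)%R * Ci.
Proof. now rewrite Cpow_add_r, Ci_pow_even, Cpow_1_r. Qed.

Lemma is_series_zero : is_series (fun _ : nat => 0%R) 0%R.
Proof.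
  eapply is_series_ext; [|apply (@is_series_delta R_AbsRing R_NormedModule 0%R)].
  now intros [|n].
Qed.

(** The powers of [Ci] encode the signs: the odd ones have real part [0], and the even ones give the
    series in [y²] by which [cos] is defined. *)
Lemma is_series_cos (y : R) :
  is_series (fun n => Re (Ci ^ n) / INR (fact n) * y ^ n)%R (cos y).
Proof.
  apply (is_pseries_R (fun n => Re (Ci ^ n) / INR (fact n))%R).
  replace (cos y) with (cos y + y * 0)%R by ring.
  apply is_pseries_odd_even; apply is_pseries_R.
  - unfold cos. destruct (exist_cos y²) as [l Hl].
    apply is_series_Reals in Hl. eapply is_series_ext; [|exact Hl].
    intros n. cbv beta. rewrite Ci_pow_even, re_RtoC. unfold cos_n, Rsqr.
    simpl. now rewrite Rmult_1_r.
  - eapply is_series_ext; [|exact is_series_zero].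
    intros n. cbv beta. rewrite Ci_pow_odd, re_scal_l. simpl. unfold Rdiv. ring.
Qed.

Lemma is_series_sin (y : R) :
  is_series (fun n => Im (Ci ^ n) / INR (fact n) * y ^ n)%R (sin y).
Proof.
  apply (is_pseries_R (fun n => Im (Ci ^ n) / INR (fact n))%R).
  unfold sin. destruct (exist_sin y²) as [l Hl].
  replace (y * l)%R with (0 + y * l)%R by ring.
  apply is_pseries_odd_even; apply is_pseries_R.
  - eapply is_series_ext; [|exact is_series_zero].
    intros n. cbv beta. rewrite Ci_pow_even. simpl. unfold Rdiv. ring.
  - apply is_series_Reals in Hl. eapply is_series_ext; [|exact Hl].
    intros n. cbv beta. rewrite Ci_pow_odd, im_scal_l. unfold sin_n, Rsqr.
    replace (y ^ 2)%R with (y * y)%R by ring. simpl Im. unfold Rdiv.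
    ring_at R.
Qed.

Lemma Cexp_plus (a b : C) : Cexp (a + b) = Cexp a * Cexp b.
Proof.
  unfold Cexp, Cmult. rewrite re_plus.
  replace (Im (a + b)) with (Im a + Im b)%R by reflexivity.
  rewrite exp_plus, cos_plus, sin_plus. simpl. f_equal; ring.
Qed.

Lemma exp_coef_RtoC (x : R) (n : nat) :
  exp_coef x n = (x ^ n / INR (fact n))%R.
Proof.
  unfold exp_coef. now rewrite RtoC_div, RtoC_pow by apply INR_fact_neq_0.
Qed.

(** Splitting [a] into its real and imaginary parts turns the series into the Cauchy product of a
    real exponential series and a series with sum [cos + i sin]. *)
Lemma is_Cseries_exp_coef (a : C) : is_Cseries (exp_coef a) (Cexp a).
Proof.
  replace a with (Re a + Im a * Ci) at 1 2 by
    (apply injective_projections; unfold Re, Im; simpl; ring).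
  rewrite Cexp_plus.
  apply is_Cseries_ext with (1 := conv_exp_coef (Re a) (Im a * Ci)).
  apply is_Cseries_conv; try apply ex_series_exp_coef; apply is_Cseries_components.
  - replace (Cexp (Re a)) with (RtoC (exp (Re a))).
    + split.
      * eapply is_series_ext; [|exact (is_series_exp (Re a))]. intros n.
        now rewrite exp_coef_RtoC.
      * eapply is_series_ext; [|exact is_series_zero]. intros n. cbv beta.
        now rewrite exp_coef_RtoC.
    + unfold Cexp, RtoC. simpl. rewrite cos_0, sin_0. f_equal; ring.
  - replace (Cexp (Im a * Ci)) with (cos (Im a), sin (Im a)).
    + assert (E : forall n, exp_coef (Im a * Ci) n
        = RtoC (Im a ^ n / INR (fact n)) * Ci ^ n).
      { intros n. unfold exp_coef.
        rewrite Cpow_mult_l, RtoC_div, RtoC_pow by apply INR_fact_neq_0.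
        field. apply RtoC_fact_neq_0. }
      split.
      * eapply is_series_ext; [|exact (is_series_cos (Im a))]. intros n.
        rewrite E, re_scal_l. unfold Rdiv.
        ring_at R.
      * eapply is_series_ext; [|exact (is_series_sin (Im a))]. intros n.
        rewrite E, im_scal_l. unfold Rdiv.
        ring_at R.
    + unfold Cexp. rewrite re_scal_l, im_scal_l. simpl.
      rewrite Rmult_0_r, Rmult_1_r, exp_0. f_equal; ring.
Qed.

Lemma is_Cpseries_exp_coef (a t : C) :
  is_Cseries (fun n => exp_coef a n * t ^ n) (Cexp (a * t)).
Proof.
  eapply is_Cseries_ext; [|apply is_Cseries_exp_coef].
  intros n. unfold exp_coef. rewrite Cpow_mult_l. unfold Cdiv.
  ring_at C.
Qed.

Lemma ex_series_exp_coef_pow (a t : C) :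
  ex_series (fun n => Cmod (exp_coef a n * t ^ n)).
Proof.
  eapply ex_series_ext; [|apply (ex_series_exp_coef (a * t))].
  intros n. apply (f_equal Cmod). unfold exp_coef. rewrite Cpow_mult_l.
  unfold Cdiv. ring_at C.
Qed.

(** * Existence of the Bernoulli polynomials *)

Definition delta_coef (m : nat) (v : C) (n : nat) : C :=
  if Nat.eqb n m then v else 0.

Lemma is_Cpseries_delta (m : nat) (v t : C) :
  is_Cseries (fun n => delta_coef m v n * t ^ n) (v * t ^ m).
Proof.
  revert v. induction m as [|m IH]; intros v.
  - eapply is_Cseries_ext; [|apply (@is_series_delta C_AbsRing C_NormedModule)].
    intros [|n]; [reflexivity|]. unfold delta_coef. simpl Nat.eqb.
    unfold zero; simpl. ring_at C.
  - apply (@is_series_decr_1 C_AbsRing C_NormedModule).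
    eapply is_Cseries_ext with (fun k => t * (delta_coef m v k * t ^ k)).
    + intros n. unfold delta_coef. simpl Nat.eqb. rewrite Cpow_S. ring_at C.
    + replace (plus _ _) with (t * (v * t ^ m)); [apply is_Cseries_scal, IH|].
      unfold delta_coef, plus, opp; simpl. ring_at C.
Qed.

Lemma delta_coef_bounded (m : nat) (v : C) (r : R) (n : nat) :
  (0 <= r)%R -> (Cmod (delta_coef m v n) * r ^ n <= Cmod v * r ^ m)%R.
Proof.
  intros Hr. unfold delta_coef. destruct (Nat.eqb_spec n m) as [->|H].
  - apply Rle_refl.
  - rewrite Cmod_0, Rmult_0_l. apply Rmult_le_pos; [apply Cmod_ge_0|now apply pow_le].
Qed.

Lemma ex_series_Cpseries_delta (m : nat) (v t : C) :
  ex_series (fun n => Cmod (delta_coef m v n * t ^ n)).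
Proof.
  apply (ex_series_Cmod_pow _ (Cmod v * (Cmod t + 1) ^ m) (Cmod t + 1)); [|lra].
  intros n. apply delta_coef_bounded. generalize (Cmod_ge_0 t). lra.
Qed.

(* [t / (e^t - 1) = w cot w - t / 2] with [t = 2 i w]. *)
Definition bernoulli_coef (n : nat) : C :=
  xcot_coef n * (- Ci / 2) ^ n - delta_coef 1 (1 / 2) n.

(** Since [- Ci / 2] has modulus [1 / 2], the bound for [xcot_coef] at [r / 2 < PI] applies; the
    linear correction is a single term. *)
Lemma bernoulli_coef_bounded (r : R) :
  (0 <= r < 2 * PI)%R ->
  exists M : R, forall n, (Cmod (bernoulli_coef n) * r ^ n <= M)%R.
Proof.
  intros Hr. destruct (xcot_coef_bounded (r / 2)) as [M HM]; [lra|].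
  exists (M + Cmod (1 / 2) * r ^ 1)%R. intros n.
  eapply Rle_trans; [apply Rmult_le_compat_r; [apply pow_le; lra|apply Cmod_triangle]|].
  rewrite Rmult_plus_distr_r. apply Rplus_le_compat.
  - eapply Rle_trans; [|apply (HM n)].
    rewrite Cmod_mult, Cmod_R, Cmod_pow, Cmod_div, Cmod_opp, Cmod_Ci, Cmod_R, (Rabs_pos_eq 2).
    + right. unfold Rdiv. rewrite !Rpow_mult_distr, pow1. ring.
    + lra.
    + intros H. apply (f_equal Re) in H. simpl in H. lra.
  - rewrite Cmod_opp. apply delta_coef_bounded. lra.
Qed.

Lemma ex_series_bernoulli_coef (t : C) :
  (Cmod t < 2 * PI)%R -> ex_series (fun n => Cmod (bernoulli_coef n * t ^ n)).
Proof.
  intros Ht. pose proof (Cmod_ge_0 t).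
  destruct (bernoulli_coef_bounded ((Cmod t + 2 * PI) / 2)) as [M HM]; [lra|].
  apply (ex_series_Cmod_pow _ M ((Cmod t + 2 * PI) / 2)); [exact HM|lra].
Qed.

(** On the disc of radius [2 * PI] this is [t / (e^t - 1)], continued by [1] at [t = 0]. *)
Definition bernoulli_sum (t : C) : C := CSeries (fun n => bernoulli_coef n * t ^ n).

Lemma is_Cseries_RtoC (u : nat -> R) (l : R) :
  is_series u l -> is_Cseries (fun n => RtoC (u n)) l.
Proof.
  intros H. apply is_Cseries_components. split; [exact H|exact is_series_zero].
Qed.

Lemma two_Ci_pow (x : R) (n : nat) : (- Ci / 2) ^ n * (2 * Ci * x) ^ n = (x ^ n)%R.
Proof.
  rewrite <- Cpow_mult_l, RtoC_pow. f_equal.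
  replace (- Ci / 2 * (2 * Ci * x)) with (- (Ci * Ci) * x) by (field; intros H; injection H; lra).
  apply injective_projections; simpl; ring.
Qed.

Lemma Cmod_two_Ci (x : R) : (0 < x)%R -> Cmod (2 * Ci * x) = (2 * x)%R.
Proof.
  intros Hx. rewrite !Cmod_mult, Cmod_Ci, !Cmod_R, !Rabs_pos_eq by lra. ring.
Qed.

(** Here the sum equals [x cot x - i x]. After the double-angle formulas, the real and imaginary
    parts of the identity both follow from [PSeries_xcot]. *)
Lemma bernoulli_sum_imaginary (x : R) :
  (0 < x < PI)%R ->
  bernoulli_sum (2 * Ci * x) * (Cexp (2 * Ci * x) - 1) = 2 * Ci * x.
Proof.
  intros Hx.
  replace (bernoulli_sum (2 * Ci * x)) with (PSeries xcot_coef x - Ci * x).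
  - pose proof (PSeries_xcot x Hx) as E.
    replace (Cexp (2 * Ci * x)) with (cos (2 * x), sin (2 * x)).
    + rewrite sin_2a, cos_2a_sin.
      pose proof (sin2_cos2 x) as E2. unfold Rsqr in E2.
      set (G := PSeries xcot_coef x) in *.
      apply injective_projections; simpl.
      * transitivity (-2 * sin x * (G * sin x) + 2 * x * sin x * cos x)%R; [ring|].
        rewrite E. ring.
      * transitivity (2 * cos x * (G * sin x) + 2 * x * (sin x * sin x))%R; [ring|].
        rewrite E. replace (sin x * sin x)%R with (1 - cos x * cos x)%R by lra. ring.
    + unfold Cexp.
      replace (Re (2 * Ci * x)) with 0%R by (simpl; ring).
      replace (Im (2 * Ci * x)) with (2 * x)%R by (simpl; ring).
      now rewrite exp_0, !Rmult_1_l.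
  - symmetry. apply is_Cseries_unique.
    eapply is_Cseries_ext; [|apply is_Cseries_minus].
    2: { apply is_Cseries_RtoC, (is_series_xcot_coef x). rewrite Rabs_pos_eq; lra. }
    2: { replace (Ci * x) with (1 / 2 * (2 * Ci * x) ^ 1)
           by (rewrite Cpow_1_r; field; intros H; injection H; lra).
         apply is_Cpseries_delta. }
    intros n. unfold bernoulli_coef. cbv beta.
    rewrite RtoC_mult, <- two_Ci_pow. ring_at C.
Qed.

Lemma is_Cpseries_bernoulli_coef (t : C) :
  (Cmod t < 2 * PI)%R ->
  is_Cseries (fun n => bernoulli_coef n * t ^ n) (bernoulli_sum t).
Proof. intros Ht. now apply is_CSeries_abs, ex_series_bernoulli_coef. Qed.

(** Identity theorem: the left side is a power series whose coefficients are determined on a segment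
    of the imaginary axis, where it equals [t]. *)
Lemma bernoulli_sum_eq (t : C) :
  (Cmod t < 2 * PI)%R -> bernoulli_sum t * (Cexp t - 1) = t.
Proof.
  set (e := fun n => exp_coef 1 n - delta_coef 0 1 n).
  assert (He : forall s, is_Cseries (fun n => e n * s ^ n) (Cexp s - 1)).
  { intros s. replace (Cexp s - 1) with (Cexp (1 * s) - 1 * s ^ 0)
      by (simpl; rewrite !Cmult_1_l; reflexivity).
    eapply is_Cseries_ext; [|exact (is_Cseries_minus _ _ _ _
      (is_Cpseries_exp_coef 1 s) (is_Cpseries_delta 0 1 s))].
    intros n. unfold e. cbv beta. ring_at C. }
  assert (He' : forall s, ex_series (fun n => Cmod (e n * s ^ n))).
  { intros s. apply (@ex_series_le R_AbsRing R_CompleteNormedModule) with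
      (fun n => Cmod (exp_coef 1 n * s ^ n) + Cmod (delta_coef 0 1 n * s ^ n))%R.
    - intros n. change (Rabs (Cmod (e n * s ^ n)) <=
        Cmod (exp_coef 1 n * s ^ n) + Cmod (delta_coef 0 1 n * s ^ n))%R.
      rewrite Rabs_pos_eq by apply Cmod_ge_0.
      rewrite <- (Cmod_opp (delta_coef 0 1 n * s ^ n)).
      eapply Rle_trans; [|apply Cmod_triangle]. right. apply (f_equal Cmod).
      unfold e. ring_at C.
    - apply (@ex_series_plus R_AbsRing R_NormedModule);
        [apply ex_series_exp_coef_pow|apply ex_series_Cpseries_delta]. }
  assert (Hc : forall s, (Cmod s < 2 * PI)%R ->
    is_Cseries (fun n => conv bernoulli_coef e n * s ^ n)
      (bernoulli_sum s * (Cexp s - 1))).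
  { intros s Hs. apply is_Cpseries_conv; auto.
    - now apply is_Cpseries_bernoulli_coef.
    - now apply ex_series_bernoulli_coef. }
  (* Substituting [2 * Ci * x] for [t] yields power series in the real variable [x], at the cost of
     a nonzero factor [(2 * Ci) ^ n] that is cancelled at the end. *)
  assert (Hg : forall n, conv bernoulli_coef e n * (2 * Ci) ^ n
    = delta_coef 1 1 n * (2 * Ci) ^ n).
  { apply (Cpseries_coef_unique _ _ PI (fun x => 2 * Ci * x) PI_RGT_0).
    - intros x Hx. rewrite <- (bernoulli_sum_imaginary x Hx).
      eapply is_Cseries_ext; [|apply Hc].
      + intros n. cbv beta. rewrite (Cpow_mult_l (2 * Ci)). ring_at C.
      + rewrite Cmod_two_Ci; lra.
    - intros x Hx. replace (2 * Ci * x) with (1 * (2 * Ci * x) ^ 1)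
        by (rewrite Cpow_1_r; ring).
      eapply is_Cseries_ext; [|apply is_Cpseries_delta].
      intros n. cbv beta. rewrite (Cpow_mult_l (2 * Ci)). ring_at C. }
  intros Ht. transitivity (1 * t ^ 1); [|rewrite Cpow_1_r; ring].
  rewrite <- (is_Cseries_unique _ _ (Hc t Ht)). apply is_Cseries_unique.
  eapply is_Cseries_ext; [|apply is_Cpseries_delta]. intros n. cbv beta. f_equal.
  assert (Hn : (2 * Ci) ^ n <> 0).
  { apply Cpow_nz. intros H. apply (f_equal Im) in H. simpl in H. lra. }
  specialize (Hg n). revert Hg Hn. generalize ((2 * Ci) ^ n). intros p Hg Hp.
  transitivity (delta_coef 1 1 n * p * / p); [now field|].
  now rewrite <- Hg, <- Cmult_assoc, Cinv_r, Cmult_1_r.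
Qed.

(** The witness comes from the Cauchy product of the series of [t / (e^t - 1)] and [e^(zt)]. *)
Lemma bernoulli_generating_exists : exists B, bernoulli_generating B.
Proof.
  exists (fun n z => INR (fact n) * conv bernoulli_coef (exp_coef z) n).
  intros z t Ht0 Ht. pose proof (bernoulli_sum_eq t Ht) as E.
  (* A zero of [Cexp t - 1] would force [t = 0] through [E]. *)
  assert (He : Cexp t - 1 <> 0).
  { intros H. rewrite H, Cmult_0_r in E. now symmetry in E. }
  replace (t * Cexp (z * t) / (Cexp t - 1)) with (bernoulli_sum t * Cexp (z * t)).
  2: { transitivity (bernoulli_sum t * (Cexp t - 1) * Cexp (z * t) / (Cexp t - 1));
         [now field|now rewrite E]. }
  eapply is_series_ext;
    [|apply (is_Cpseries_conv bernoulli_coef (exp_coef z) t)].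
  - intros n. cbv beta. field_at C. apply RtoC_fact_neq_0.
  - now apply is_Cpseries_bernoulli_coef.
  - apply is_Cpseries_exp_coef.
  - now apply ex_series_bernoulli_coef.
  - apply ex_series_exp_coef_pow.
Qed.

(** * Growth and translation of the Bernoulli polynomials *)

(** Existence makes the choice behind [bernoulli] meet its specification, from which all later
    properties are drawn. *)
Lemma bernoulli_generating_bernoulli : bernoulli_generating bernoulli.
Proof. unfold bernoulli. apply epsilon_spec, bernoulli_generating_exists. Qed.

(** Division by [n!] makes these the coefficients of the generating function in [t], so that
    translation in [z] is a plain convolution. *)
Definition nbernoulli (n : nat) (z : C) : C := bernoulli n z / INR (fact n).

Lemma is_Cpseries_nbernoulli (z t : C) :
  t <> 0 -> (Cmod t < 2 * PI)%R ->
  is_Cseries (fun n => nbernoulli n z * t ^ n) (t * Cexp (z * t) / (Cexp t - 1)).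
Proof.
  intros Ht0 Ht.
  eapply is_Cseries_ext; [|exact (bernoulli_generating_bernoulli z t Ht0 Ht)].
  intros n. unfold nbernoulli, Cdiv. ring_at C.
Qed.

(** The terms of the convergent generating series at [t = PI] are bounded; this is the growth rate
    that the weight [n! / PI ^ n] on [c n] compensates. *)
Lemma nbernoulli_bounded (z : C) :
  exists M : R, forall n, (Cmod (nbernoulli n z) * PI ^ n <= M)%R.
Proof.
  pose proof PI_RGT_0 as Hpi.
  destruct (is_Cseries_bounded _ _ (is_Cpseries_nbernoulli z PI
    ltac:(intros H; injection H; lra) ltac:(rewrite Cmod_R, Rabs_pos_eq; lra)))
    as [M HM].
  exists M. intros n. eapply Rle_trans; [|apply (HM n)].
  rewrite Cmod_mult, Cmod_pow, Cmod_R, (Rabs_pos_eq PI) by lra. apply Rle_refl.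
Qed.

(** The generating function at [z + h] is [e^(hx)] times the one at [z]; coefficients are compared
    for real [x] between [0] and [PI]. *)
Lemma nbernoulli_add (z h : C) (n : nat) :
  nbernoulli n (z + h) = conv (exp_coef h) (fun k => nbernoulli k z) n.
Proof.
  pose proof PI_RGT_0 as Hpi.
  revert n. apply (Cpseries_coef_unique _ _ PI
    (fun x => x * Cexp ((z + h) * x) / (Cexp x - 1)) Hpi).
  - intros x Hx. apply is_Cpseries_nbernoulli.
    + intros H. injection H. lra.
    + rewrite Cmod_R, Rabs_pos_eq; lra.
  - intros x Hx.
    replace (x * Cexp ((z + h) * x) / (Cexp x - 1))
      with (Cexp (h * x) * (x * Cexp (z * x) / (Cexp x - 1)))
      by (rewrite Cmult_plus_distr_r, Cexp_plus; unfold Cdiv; ring).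
    apply is_Cpseries_conv.
    + apply is_Cpseries_exp_coef.
    + apply is_Cpseries_nbernoulli.
      * intros H. injection H. lra.
      * rewrite Cmod_R, Rabs_pos_eq; lra.
    + apply ex_series_exp_coef_pow.
    + destruct (nbernoulli_bounded z) as [M HM].
      apply (ex_series_Cmod_pow _ M PI _ HM). rewrite Cmod_R, Rabs_pos_eq; lra.
Qed.

Lemma exp_coef_0 (h : C) : exp_coef h 0 = 1.
Proof. unfold exp_coef. simpl. change (1 / 1 = 1). field. Qed.

Lemma exp_coef_1 (h : C) : exp_coef h 1 = h.
Proof. unfold exp_coef. rewrite Cpow_1_r. simpl. field. Qed.

Lemma nbernoulli_0_const (z w : C) : nbernoulli 0 z = nbernoulli 0 w.
Proof.
  replace z with (w + (z - w)) by ring. rewrite nbernoulli_add.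
  unfold conv. rewrite sum_O, exp_coef_0. apply Cmult_1_l.
Qed.

(** The derivative of [nbernoulli n], hence [0] for [n = 0]. *)
Definition nbernoulli_pred (n : nat) (z : C) : C :=
  match n with O => 0 | S m => nbernoulli m z end.

(** The remainder consists of the terms [k >= 2] of the translation formula. Writing
    [PI ^ n = PI ^ k * PI ^ (n - k)] and using [Cmod h ^ k <= Cmod h ^ 2] bounds it by
    [M * Cmod h ^ 2] times part of the series of [exp PI], uniformly in [n]. *)
Lemma nbernoulli_taylor_1 (z : C) :
  exists K : R, (0 <= K)%R /\ forall h n, (Cmod h <= 1)%R ->
  (Cmod (nbernoulli n (z + h) - nbernoulli n z - h * nbernoulli_pred n z) * PI ^ n
    <= K * Cmod h ^ 2)%R.
Proof.
  pose proof PI_RGT_0 as Hpi.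
  destruct (nbernoulli_bounded z) as [M HM].
  assert (HM0 : (0 <= M)%R).
  { eapply Rle_trans; [|apply (HM 0%nat)]. apply Rmult_le_pos;
      [apply Cmod_ge_0|apply pow_le; lra]. }
  assert (HK : (0 <= M * exp PI)%R).
  { apply Rmult_le_pos; [easy|]. left. apply exp_pos. }
  exists (M * exp PI)%R. split; [exact HK|]. intros h n Hh.
  assert (Hh0 := Cmod_ge_0 h).
  assert (Hz : forall w : C, w = 0 -> (Cmod w * PI ^ n <= M * exp PI * Cmod h ^ 2)%R).
  { intros w ->. rewrite Cmod_0, Rmult_0_l. apply Rmult_le_pos; [easy|].
    now apply pow_le. }
  destruct n as [|[|m]].
  - apply Hz. rewrite (nbernoulli_0_const (z + h) z). simpl. ring.
  - apply Hz. rewrite nbernoulli_add. unfold conv.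
    rewrite sum_n_Sl, sum_O, exp_coef_0, exp_coef_1. simpl. ring.
  - clear Hz. rewrite nbernoulli_add. unfold conv at 1.
    rewrite !sum_n_Sl, exp_coef_0, exp_coef_1. simpl nbernoulli_pred.
    simpl Nat.sub.
    (* The terms of order [0] and [1] cancel; [v] is the remaining tail, with [k] standing for order
       [k + 2]. *)
    match goal with |- context [@sum_n _ ?u m] =>
      set (v := u); replace (_ - _ - _) with (@sum_n C_NormedModule v m) end.
    2: { symmetry. ring_at C. }
    apply Rle_trans with (sum_n (fun k =>
      (M * Cmod h ^ 2) * (PI ^ (S (S k)) / INR (fact (S (S k)))))%R m).
    + eapply Rle_trans.
      { apply Rmult_le_compat_r; [apply pow_le; lra|apply Cmod_sum_n_le]. }
      rewrite Rmult_comm.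
      change (PI ^ S (S m) * ?y)%R with (@mult R_Ring (PI ^ S (S m))%R y).
      rewrite <- (@sum_n_mult_l R_Ring).
      rewrite !sum_n_Reals. apply sum_Rle. intros k Hk.
      change (@mult R_Ring ?x ?y) with (x * y)%R. unfold v.
      rewrite Cmod_mult, Cmod_exp_coef.
      replace (S (S m)) with (S (S k) + (m - k))%nat at 1 by lia.
      rewrite pow_add.
      apply Rle_trans with (PI ^ (S (S k)) * (Cmod h ^ S (S k) / INR (fact (S (S k))))
        * (Cmod (nbernoulli (m - k) z) * PI ^ (m - k)))%R; [right; ring|].
      apply Rle_trans with (PI ^ (S (S k)) * (Cmod h ^ 2 / INR (fact (S (S k)))) * M)%R;
        [|right; unfold Rdiv; ring].
      assert (Hf := INR_fact_lt_0 (S (S k))).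
      apply Rmult_le_compat; [| |apply Rmult_le_compat_l|apply HM].
      * apply Rmult_le_pos; [apply pow_le; lra|].
        apply Rdiv_le_0_compat; [now apply pow_le|easy].
      * apply Rmult_le_pos; [apply Cmod_ge_0|apply pow_le; lra].
      * apply pow_le; lra.
      * apply Rmult_le_compat_r; [left; now apply Rinv_0_lt_compat|].
        assert (Cmod h ^ k <= 1)%R by (rewrite <- (pow1 k); apply pow_incr; lra).
        assert (0 <= Cmod h ^ k)%R by now apply pow_le.
        simpl. nra.
    + rewrite sum_n_Reals.
      rewrite (sum_eq _ (fun k => PI ^ S (S k) / INR (fact (S (S k)))
        * (M * Cmod h ^ 2))%R) by (intros; ring).
      rewrite <- scal_sum.
      apply Rle_trans with (M * Cmod h ^ 2 * exp PI)%R; [|right; ring].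
      apply Rmult_le_compat_l.
      { apply Rmult_le_pos; [easy|now apply pow_le]. }
      (* The sum is the Taylor polynomial of [exp PI] without its nonnegative terms [1] and [PI]. *)
      eapply Rle_trans; [|apply (exp_ge_taylor PI (S (S m))); lra].
      rewrite (decomp_sum (fun k => PI ^ k / INR (fact k))%R (S (S m))) by lia.
      rewrite (decomp_sum (fun k => PI ^ (S k) / INR (fact (S k)))%R) by (simpl; lia).
      simpl pred. simpl (PI ^ 0)%R. simpl (INR (fact 0)). simpl (INR (fact 1)).
      simpl (PI ^ 1)%R. lra.
Qed.

(** * Series of Bernoulli polynomials *)

Definition PI_summable (d : nat -> C) : Prop :=
  ex_series (fun n => Cmod (d n) / PI ^ n)%R.

Definition nbernoulli_series (d : nat -> C) (z : C) : C :=
  CSeries (fun n => d n * nbernoulli n z).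

Lemma PI_pow_pos (n : nat) : (0 < PI ^ n)%R.
Proof. apply pow_lt, PI_RGT_0. Qed.

Lemma ex_nbernoulli_series (d : nat -> C) (z : C) :
  PI_summable d -> ex_series (fun n => Cmod (d n * nbernoulli n z)).
Proof.
  intros Hd. destruct (nbernoulli_bounded z) as [M HM].
  apply (@ex_series_le R_AbsRing R_CompleteNormedModule) with
    (fun n => M * (Cmod (d n) / PI ^ n))%R.
  - intros n. change (Rabs (Cmod (d n * nbernoulli n z)) <= M * (Cmod (d n) / PI ^ n))%R.
    rewrite Rabs_pos_eq, Cmod_mult by apply Cmod_ge_0.
    pose proof (PI_pow_pos n) as Hp.
    replace (Cmod (d n) * Cmod (nbernoulli n z))%R
      with (Cmod (nbernoulli n z) * PI ^ n * (Cmod (d n) / PI ^ n))%R by (field; lra).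
    apply Rmult_le_compat_r; [|apply HM].
    apply Rdiv_le_0_compat; [apply Cmod_ge_0|easy].
  - apply (@ex_series_scal R_AbsRing R_NormedModule), Hd.
Qed.

Lemma is_nbernoulli_series (d : nat -> C) (z : C) :
  PI_summable d ->
  is_Cseries (fun n => d n * nbernoulli n z) (nbernoulli_series d z).
Proof. intros Hd. now apply is_CSeries_abs, ex_nbernoulli_series. Qed.

Lemma PI_summable_S (d : nat -> C) :
  PI_summable d <-> PI_summable (fun n => d (S n)).
Proof.
  pose proof PI_RGT_0 as Hpi. unfold PI_summable. split; intros H.
  - apply (@ex_series_incr_1 R_AbsRing R_NormedModule) in H.
    apply (@ex_series_scal R_AbsRing R_NormedModule PI) in H.
    eapply ex_series_ext; [|exact H]. intros n. change (scal ?x ?y) with (x * y)%R.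
    simpl. field. split; [apply pow_nonzero|]; lra.
  - apply (@ex_series_incr_1 R_AbsRing R_NormedModule).
    apply (@ex_series_scal R_AbsRing R_NormedModule (/ PI)%R) in H.
    eapply ex_series_ext; [|exact H]. intros n. change (scal ?x ?y) with (x * y)%R.
    simpl. field. split; [apply pow_nonzero|]; lra.
Qed.

Lemma PI_summable_shift (d : nat -> C) (m : nat) :
  PI_summable d -> PI_summable (fun n => d (m + n)%nat).
Proof.
  intros Hd. induction m as [|m IH]; [exact Hd|].
  apply PI_summable_S in IH. eapply ex_series_ext; [|exact IH].
  intros n. cbv beta. now rewrite Nat.add_succ_r.
Qed.

(** * Complex derivatives of series of Bernoulli polynomials *)

Lemma is_C_derive_quadratic (f : C -> C) (z l : C) (K : R) :
  (0 <= K)%R ->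
  (forall h, (Cmod h <= 1)%R -> (Cmod (f (z + h)%C - f z - h * l) <= K * Cmod h ^ 2)%R) ->
  is_C_derive f z l.
Proof.
  intros HK H. split; [apply (@is_linear_scal_l C_AbsRing C_NormedModule)|].
  intros x Hx.
  (* The differential is defined through every limit [x] of the neighbourhood filter of [z];
     uniqueness of limits gives [x = z]. *)
  apply (@is_filter_lim_locally_unique C_AbsRing (AbsRing_NormedModule C_AbsRing)) in Hx.
  subst x. intros eps. pose proof (cond_pos eps) as He.
  (* [K + 1] keeps the quotient meaningful for [K = 0]; the bound [1] is the range where the
     quadratic estimate holds. *)
  assert (Hdel : (0 < Rmin 1 (eps / (K + 1)))%R).
  { apply Rmin_pos; [lra|]. apply Rdiv_lt_0_compat; lra. }
  exists (mkposreal _ Hdel). intros y Hy.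
  change (Cmod (y - z) < Rmin 1 (eps / (K + 1)))%R in Hy.
  change (Cmod (f y - f z - (y - z) * l) <= eps * Cmod (y - z))%R.
  replace y with (z + (y - z)) at 1 by ring.
  assert (H1 := Rlt_le_trans _ _ _ Hy (Rmin_l _ _)).
  assert (H2 := Rlt_le_trans _ _ _ Hy (Rmin_r _ _)).
  eapply Rle_trans; [apply H; lra|].
  pose proof (Cmod_ge_0 (y - z)) as H0.
  apply Rlt_div_r in H2; [|lra]. simpl. nra.
Qed.

(** Summing the uniform Taylor estimates against [d] gives a quadratic remainder with constant
    [K * W], where [W] is the weighted sum of [d]. The affine part serves both the constant in
    [f_sigma] and the linear term of its primitives. *)
Lemma is_C_derive_nbernoulli_series (d : nat -> C) (a b c : C) (z : C) :
  PI_summable d ->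
  is_C_derive (fun z => nbernoulli_series d (z + a) + b * z + c) z
    (nbernoulli_series (fun n => d (S n)) (z + a) + b).
Proof.
  intros Hd. destruct (nbernoulli_taylor_1 (z + a)) as (K & HK & HT).
  pose proof Hd as [W HW].
  assert (HW0 : (0 <= W)%R).
  { rewrite <- (is_series_unique _ _ HW), <- (Rmult_0_l (Series (fun _ => 0%R))).
    rewrite <- Series_scal_l. apply Series_le; [|now exists W].
    intros n. rewrite Rmult_0_l. split; [lra|].
    apply Rdiv_le_0_compat; [apply Cmod_ge_0|apply PI_pow_pos]. }
  apply (is_C_derive_quadratic _ _ _ (K * W)); [now apply Rmult_le_pos|].
  intros h Hh.
  set (F := nbernoulli_series d).
  set (F' := nbernoulli_series (fun n => d (S n))).
  replace (F (z + h + a) + b * (z + h) + c - (F (z + a) + b * z + c)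
    - h * (F' (z + a) + b)) with (F (z + a + h) - F (z + a) - h * F' (z + a)).
  2: { replace (z + h + a) with (z + a + h) by ring. ring. }
  set (w := z + a) in *.
  (* The zeroth term vanishes, so the termwise derivative is the series with shifted
     coefficients. *)
  assert (Hp : is_Cseries (fun n => d n * nbernoulli_pred n w) (F' w)).
  { apply (@is_series_decr_1 C_AbsRing C_NormedModule).
    simpl nbernoulli_pred. replace (plus _ _) with (F' w)
      by (unfold plus, opp; simpl; ring_at C).
    apply is_nbernoulli_series. now apply PI_summable_S in Hd. }
  apply (Cmod_is_Cseries_le
    (fun n => d n * (nbernoulli n (w + h) - nbernoulli n w - h * nbernoulli_pred n w)) _
    (fun n => K * Cmod h ^ 2 * (Cmod (d n) / PI ^ n))%R).
  - intros n. rewrite Cmod_mult. pose proof (PI_pow_pos n) as Hpn.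
    set (r := nbernoulli n (w + h) - nbernoulli n w - h * nbernoulli_pred n w).
    replace (Cmod (d n) * Cmod r)%R
      with (Cmod r * PI ^ n * (Cmod (d n) / PI ^ n))%R by (field; lra).
    apply Rmult_le_compat_r; [|now apply HT].
    apply Rdiv_le_0_compat; [apply Cmod_ge_0|easy].
  - eapply is_Cseries_ext; [|apply is_Cseries_minus;
      [apply is_Cseries_minus|apply (is_Cseries_scal h)]].
    2, 3: apply is_nbernoulli_series, Hd.
    2: exact Hp.
    intros n. cbv beta. ring_at C.
  - replace (K * W * Cmod h ^ 2)%R with (K * Cmod h ^ 2 * W)%R by ring.
    exact (@is_series_scal R_AbsRing R_NormedModule (K * Cmod h ^ 2)%R _ _ HW).
Qed.

Lemma is_C_derive_ext (f g : C -> C) (z l l' : C) :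
  (forall w, f w = g w) -> l = l' -> is_C_derive f z l -> is_C_derive g z l'.
Proof. intros H <-. exact (@is_derive_ext C_AbsRing C_NormedModule f g z l H). Qed.

Lemma is_C_derive_n_ext (f g g' : C -> C) (m : nat) :
  (forall z, g z = g' z) -> is_C_derive_n f m g -> is_C_derive_n f m g'.
Proof.
  intros H. destruct m as [|m].
  - intros Hf z. now rewrite Hf.
  - intros (h & Hh & Hd). exists h. split; [exact Hh|]. intros z. now rewrite <- H.
Qed.

(* Along the ray through [z], the real and imaginary parts of [f] are real
   functions with derivative [0]. *)
Lemma is_C_derive_0_const (f : C -> C) :
  (forall z, is_C_derive f z 0) -> forall z, f z = f 0.
Proof.
  intros Hf z.
  (* [p] stands for [Re] and [Im]; additivity and the bound by [Cmod] are all that the estimate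
     takes from them. *)
  assert (H : forall p : C -> R, (forall a b : C, p (a - b) = (p a - p b)%R) ->
    (forall a, Rabs (p a) <= Cmod a)%R -> p (f z) = p (f 0)).
  { intros p Hp Hle.
    assert (E : p (f (0%R * z)) = p (f (1%R * z))).
    { apply (@eq_is_derive R_NormedModule (fun s => p (f (RtoC s * z)))); [|lra].
      intros s _. split; [apply (@is_linear_scal_l R_AbsRing R_NormedModule)|].
      intros x Hx.
      apply (@is_filter_lim_locally_unique R_AbsRing R_NormedModule) in Hx. subst x.
      intros eps. pose proof (Cmod_ge_0 z) as Hz. pose proof (cond_pos eps) as He.
      (* Moving the parameter by [y - s] moves the point by [Rabs (y - s) * Cmod z], so tolerance
         and radius are divided by [Cmod z + 1], which is positive even for [z = 0]. *)
      assert (He' : (0 < eps / (Cmod z + 1))%R) by (apply Rdiv_lt_0_compat; lra).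
      destruct (Hf (RtoC s * z)) as [_ Hd].
      destruct (Hd (RtoC s * z) (fun P HP => HP) (mkposreal _ He')) as [del Hdel].
      assert (Hdel' : (0 < del / (Cmod z + 1))%R).
      { apply Rdiv_lt_0_compat; [apply cond_pos|lra]. }
      exists (mkposreal _ Hdel'). intros y Hy.
      change (Rabs (y - s) < del / (Cmod z + 1))%R in Hy.
      apply Rlt_div_r in Hy; [|lra].
      assert (Ey : Cmod (RtoC y * z - RtoC s * z) = (Rabs (y - s) * Cmod z)%R).
      { replace (RtoC y * z - RtoC s * z) with (RtoC (y - s) * z)
          by (rewrite RtoC_minus; ring).
        now rewrite Cmod_mult, Cmod_R. }
      assert (Hys := Rabs_pos (y - s)).
      specialize (Hdel (RtoC y * z)).
      change (Cmod (RtoC y * z - RtoC s * z) < del ->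
        Cmod (f (RtoC y * z)%C - f (RtoC s * z)%C - (RtoC y * z - RtoC s * z) * 0)
          <= eps / (Cmod z + 1) * Cmod (RtoC y * z - RtoC s * z))%R in Hdel.
      rewrite Ey, Cmult_0_r in Hdel. specialize (Hdel ltac:(nra)).
      change (Rabs (p (f (RtoC y * z)%C) - p (f (RtoC s * z)%C) - (y - s) * 0)
        <= eps * Rabs (y - s))%R.
      rewrite Rmult_0_r, Rminus_0_r, <- Hp.
      eapply Rle_trans; [apply Hle|].
      replace (f (RtoC y * z) - f (RtoC s * z))
        with (f (RtoC y * z) - f (RtoC s * z) - 0) by ring.
      eapply Rle_trans; [exact Hdel|].
      apply Rle_trans with (eps * Rabs (y - s) * (Cmod z / (Cmod z + 1)))%R;
        [right; field; lra|].
      rewrite <- (Rmult_1_r (eps * Rabs (y - s))) at 2.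
      apply Rmult_le_compat_l; [apply Rmult_le_pos; lra|].
      apply Rle_div_l; lra. }
    rewrite Cmult_0_l, Cmult_1_l in E. now symmetry. }
  apply injective_projections.
  - apply (H Re); [reflexivity|apply re_le_Cmod].
  - apply (H Im); [reflexivity|apply im_le_Cmod].
Qed.

(** * The analytic summand, its derivatives and its primitives *)

Lemma bernoulli_nbernoulli (n : nat) (z : C) :
  bernoulli n z = INR (fact n) * nbernoulli n z.
Proof. unfold nbernoulli. field. apply RtoC_fact_neq_0. Qed.

Lemma Spoly_nbernoulli (n : nat) (z : C) :
  Spoly n z = INR (fact n) * (nbernoulli (S n) (z + 1) - nbernoulli (S n) 1).
Proof.
  unfold Spoly, bernoulli_second. rewrite Nat.add_1_r, !bernoulli_nbernoulli.
  rewrite fact_simpl, mult_INR, RtoC_mult. field. apply RtoC_INR_S_neq_0.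
Qed.

(** [nbernoulli 0] is constant, so the zeroth term of the difference drops out whatever [d 0] is. *)
Lemma is_Cseries_nbernoulli_diff (d : nat -> C) (w v : C) :
  PI_summable d ->
  is_Cseries (fun k => d (S k) * (nbernoulli (S k) w - nbernoulli (S k) v))
    (nbernoulli_series d w - nbernoulli_series d v).
Proof.
  intros Hd.
  apply (is_Cseries_incr_1 (fun k => d k * (nbernoulli k w - nbernoulli k v))).
  { rewrite (nbernoulli_0_const w v). ring. }
  eapply is_Cseries_ext;
    [|apply is_Cseries_minus; apply is_nbernoulli_series, Hd].
  intros n. cbv beta. ring_at C.
Qed.

(* The coefficients for which [f_sigma z = sum d n * (b n (z + 1) - b n 1)],
   where [b n] is the [n]-th Bernoulli polynomial divided by [n!]; each
   derivative of [f_sigma] shifts [d] by one. *)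
Definition summand_coef (c : nat -> C) (n : nat) : C :=
  match n with O => 0 | S k => c k * INR (fact k) end.

Lemma summand_coef_summable (c : nat -> C) :
  ex_series (fun n => Cmod (INR (fact n) / PI ^ n * c n)) ->
  PI_summable (summand_coef c).
Proof.
  intros H. apply PI_summable_S. eapply ex_series_ext; [|exact H].
  intros n. pose proof (PI_pow_pos n) as Hp. cbv beta. simpl summand_coef.
  rewrite <- RtoC_pow, <- RtoC_div, !Cmod_mult, !Cmod_R by lra.
  unfold Rdiv. rewrite Rabs_mult, (Rabs_pos_eq (/ _)).
  - ring_at R.
  - left. now apply Rinv_0_lt_compat.
Qed.

Section Summand.

Context (c : nat -> C) (hc : PI_summable (summand_coef c)).

Let d (m n : nat) : C := summand_coef c (m + n).

Local Lemma d_summable (m : nat) : PI_summable (d m).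
Proof. now apply PI_summable_shift. Qed.

(** The factor [k!] in [Spoly k] cancels the denominator. The index [m + k - m] is left unreduced to
    match the unfolding of [CSeries_from]. *)
Lemma is_Cseries_Spoly (m : nat) (z : C) :
  is_Cseries (fun k => INR (fact (m + k)) / INR (fact (m + k - m)) * c (m + k)%nat
      * Spoly (m + k - m) z)
    (nbernoulli_series (d m) (z + 1) - nbernoulli_series (d m) 1).
Proof.
  eapply is_Cseries_ext; [|exact (is_Cseries_nbernoulli_diff _ _ _ (d_summable m))].
  intros k. unfold d. replace (m + k - m)%nat with k by lia.
  rewrite Nat.add_succ_r, Spoly_nbernoulli. simpl summand_coef.
  field_at C. apply RtoC_fact_neq_0.
Qed.

(** For [m >= 1], [d m k] is [(m - 1 + k)!] times [c (m - 1 + k)], so the exceptional value of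
    [summand_coef] at [0] does not occur. *)
Lemma is_Cseries_bernoulli (m : nat) (w : C) :
  (1 <= m)%nat ->
  is_Cseries (fun k => INR (fact (m - 1 + k)) / INR (fact (m - 1 + k + 1 - m))
      * c (m - 1 + k)%nat * bernoulli (m - 1 + k + 1 - m) w)
    (nbernoulli_series (d m) w).
Proof.
  intros Hm. eapply is_Cseries_ext; [|exact (is_nbernoulli_series _ w (d_summable m))].
  intros k. unfold d. replace (m - 1 + k + 1 - m)%nat with k by lia.
  destruct m as [|m]; [lia|]. replace (S m - 1)%nat with m by lia. simpl summand_coef.
  rewrite bernoulli_nbernoulli.
  field_at C. apply RtoC_fact_neq_0.
Qed.

Lemma is_Cseries_lambda_n (m : nat) :
  (1 <= m)%nat ->
  is_Cseries (fun k => lambda_n_term c m (m - 1 + k)) (nbernoulli_series (d m) 1).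
Proof.
  intros Hm. eapply is_Cseries_ext; [|exact (is_Cseries_bernoulli m 1 Hm)].
  intros k. unfold lambda_n_term, bernoulli_second. ring_at C.
Qed.

Lemma lambda_n_eq (m : nat) :
  (1 <= m)%nat -> lambda_n c m = nbernoulli_series (d m) 1.
Proof.
  intros Hm. destruct m as [|m]; [lia|].
  exact (is_Cseries_unique _ _ (is_Cseries_lambda_n (S m) Hm)).
Qed.

Lemma is_Cseries_lambda : is_Cseries (lambda_term c) (nbernoulli_series (d 1) 1).
Proof.
  eapply is_Cseries_ext; [|exact (is_nbernoulli_series _ 1 (d_summable 1))].
  intros n. unfold d, lambda_term, bernoulli_second. simpl summand_coef.
  rewrite bernoulli_nbernoulli. ring_at C.
Qed.

(** From [n! / n = (n - 1)!]; the sum may start at [1] because [d 0 0 = 0]. *)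
Lemma is_Cseries_mu :
  is_Cseries (fun k => mu_term c (1 + k)) (nbernoulli_series (d 0) 1).
Proof.
  apply (@is_series_ext C_AbsRing C_NormedModule
    (fun k => d 0 (S k) * nbernoulli (S k) 1)).
  - intros k. unfold d, mu_term, bernoulli_second. simpl summand_coef.
    rewrite bernoulli_nbernoulli. replace (1 + k - 1)%nat with k by lia.
    change (1 + k)%nat with (S k). rewrite fact_simpl, mult_INR, RtoC_mult.
    field_at C. apply RtoC_INR_S_neq_0.
  - apply (is_Cseries_incr_1 (fun k => d 0 k * nbernoulli k 1)).
    { apply Cmult_0_l. }
    apply (is_nbernoulli_series _ _ (d_summable 0)).
Qed.

Lemma analytic_summand_eq (z : C) :
  analytic_summand c z = nbernoulli_series (d 0) (z + 1) - nbernoulli_series (d 0) 1.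
Proof.
  apply is_Cseries_unique. eapply is_Cseries_ext; [|exact (is_Cseries_Spoly 0 z)].
  intros n. cbv beta. rewrite Nat.add_0_l, Nat.sub_0_r.
  field_at C. apply RtoC_fact_neq_0.
Qed.

Lemma is_C_derive_n_analytic_summand (m : nat) :
  is_C_derive_n (analytic_summand c) (S m)
    (fun z => nbernoulli_series (d (S m)) (z + 1)).
Proof.
  (* The constant [b] is minus the value at [1] for the first derivative and [0] for the later
     ones. *)
  assert (Hd : forall m b z, is_C_derive (fun z => nbernoulli_series (d m) (z + 1) + b) z
    (nbernoulli_series (d (S m)) (z + 1))).
  { clear m. intros m b z.
    eapply is_C_derive_ext; [| |exact (is_C_derive_nbernoulli_series (d m) 1 0 b z (d_summable m))].
    - intros w. cbv beta. ring.
    - rewrite Cplus_0_r. unfold nbernoulli_series, d, CSeries.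
      f_equal; apply Series_ext; intros n; now rewrite Nat.add_succ_r. }
  induction m as [|m IH].
  - exists (analytic_summand c). split; [easy|]. intros z.
    eapply is_C_derive_ext; [|reflexivity|exact (Hd 0%nat (- nbernoulli_series (d 0) 1) z)].
    intros w. now rewrite analytic_summand_eq.
  - eexists. split; [exact IH|]. intros z.
    eapply is_C_derive_ext; [|reflexivity|exact (Hd (S m) 0 z)].
    intros w. cbv beta. ring.
Qed.

Lemma ex_series_Spoly_abs (z : C) : ex_series (fun n => Cmod (c n * Spoly n z)).
Proof.
  pose proof (d_summable 0) as H0.
  apply (@ex_series_le R_AbsRing R_CompleteNormedModule) with
    (fun n => Cmod (d 0 (S n) * nbernoulli (S n) (z + 1))
      + Cmod (d 0 (S n) * nbernoulli (S n) 1))%R.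
  - intros n. change (norm ?x) with (Rabs x). rewrite Rabs_pos_eq by apply Cmod_ge_0.
    rewrite <- (Cmod_opp (d 0 (S n) * nbernoulli (S n) 1)).
    eapply Rle_trans; [|apply Cmod_triangle]. right. apply (f_equal Cmod).
    unfold d. simpl summand_coef. rewrite Spoly_nbernoulli. ring_at C.
  - apply (@ex_series_plus R_AbsRing R_NormedModule).
    + apply (@ex_series_incr_1 R_AbsRing R_NormedModule
        (fun n => Cmod (d 0 n * nbernoulli n (z + 1)))).
      now apply ex_nbernoulli_series.
    + apply (@ex_series_incr_1 R_AbsRing R_NormedModule
        (fun n => Cmod (d 0 n * nbernoulli n 1))).
      now apply ex_nbernoulli_series.
Qed.

(** Prepending a zero undoes one differentiation, as [e (S n) = d 0 n]. *)
Let e (n : nat) : C := match n with O => 0 | S k => summand_coef c k end.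

Local Lemma e_summable : PI_summable e.
Proof. apply PI_summable_S. exact hc. Qed.

Lemma is_Cseries_primitive (z : C) :
  is_Cseries (fun n => c n / INR (n + 1) * Spoly (n + 1) z)
    (nbernoulli_series e (z + 1) - nbernoulli_series e 1).
Proof.
  eapply is_Cseries_ext.
  (* Besides index [0], index [1] is dropped too, because [e 1 = summand_coef c 0 = 0]. *)
  2: { apply (is_Cseries_incr_1
         (fun k => e (S k) * (nbernoulli (S k) (z + 1) - nbernoulli (S k) 1))).
       { apply Cmult_0_l. }
       exact (is_Cseries_nbernoulli_diff _ _ _ e_summable). }
  intros n. cbv beta. rewrite Nat.add_1_r, Spoly_nbernoulli.
  change (e (S (S n))) with (c n * INR (fact n)).
  rewrite fact_simpl, mult_INR, RtoC_mult.
  field_at C. apply RtoC_INR_S_neq_0.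
Qed.

(** The [e]-series at [z + 1] differentiates to the [d 0]-series there, which exceeds [f_sigma] by
    its value at [1]; that value is [mu c], hence the term [- mu c * z]. *)
Lemma is_C_derive_primitive (K z : C) :
  is_C_derive (fun z => CSeries (fun n => c n / INR (n + 1) * Spoly (n + 1) z)
    - mu c * z + K) z (analytic_summand c z).
Proof.
  eapply is_C_derive_ext; [| |exact (is_C_derive_nbernoulli_series e 1 (- mu c)
    (- nbernoulli_series e 1 + K) z e_summable)].
  - intros w. cbv beta. rewrite (is_Cseries_unique _ _ (is_Cseries_primitive w)). ring.
  - rewrite analytic_summand_eq. unfold mu, CSeries_from.
    rewrite (is_Cseries_unique _ _ is_Cseries_mu). reflexivity.
Qed.

End Summand.

Lemma is_C_derive_eq_const (f g : C -> C) (h : C -> C) :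
  (forall z, is_C_derive f z (h z)) -> (forall z, is_C_derive g z (h z)) ->
  forall z, f z = g z + (f 0 - g 0).
Proof.
  intros Hf Hg z.
  enough (E : f z - g z = f 0 - g 0) by (rewrite <- E; ring).
  apply (is_C_derive_0_const (fun z => f z - g z)). intros w.
  replace (RtoC 0) with (h w - h w) by ring.
  exact (@is_derive_minus C_AbsRing C_NormedModule f g w _ _ (Hf w) (Hg w)).
Qed.

Theorem theorem2p1 (c : nat -> C)
  (hc : ex_series (fun n => Cmod (INR (fact n) / PI ^ n * c n))) :
  absolutely_entirely_summable c /\
  (* (a), first derivative *)
  (ex_Cseries_from 0 (lambda_term c) /\
   (forall z : C,
      ex_Cseries_from 1 (fun n => INR n * c n * Spoly (n - 1) z)) /\
   forall z : C,
     is_C_derive (analytic_summand c) z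
       (CSeries_from 1 (fun n => INR n * c n * Spoly (n - 1) z) + lambda c)) /\
  (* (a), derivatives of every order *)
  (forall m : nat,
     ((1 <= m)%nat -> ex_Cseries_from (m - 1) (lambda_n_term c m)) /\
     (forall z : C,
        ex_Cseries_from m
          (fun n => INR (fact n) / INR (fact (n - m)) * c n
                    * Spoly (n - m) z)) /\
     is_C_derive_n (analytic_summand c) m
       (fun z =>
          CSeries_from m
            (fun n => INR (fact n) / INR (fact (n - m)) * c n
                      * Spoly (n - m) z)
          + lambda_n c m)) /\
  lambda_n c 1 = lambda c /\
  (* (a), form with Bernoulli polynomials *)
  (forall m : nat, (1 <= m)%nat ->
     (forall z : C,
        ex_Cseries_from (m - 1)
          (fun n => INR (fact n) / INR (fact (n + 1 - m)) * c n
                    * bernoulli (n + 1 - m) (z + 1))) /\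
     is_C_derive_n (analytic_summand c) m
       (fun z =>
          CSeries_from (m - 1)
            (fun n => INR (fact n) / INR (fact (n + 1 - m)) * c n
                      * bernoulli (n + 1 - m) (z + 1)))) /\
  (* (b) *)
  (ex_Cseries_from 1 (mu_term c) /\
   (forall z : C,
      ex_Cseries_from 0 (fun n => c n / INR (n + 1) * Spoly (n + 1) z)) /\
   forall F : C -> C,
     (forall z : C, is_C_derive F z (analytic_summand c z)) <->
     exists K : C, forall z : C,
       F z = CSeries_from 0 (fun n => c n / INR (n + 1) * Spoly (n + 1) z)
             - mu c * z + K).
Proof.
  apply summand_coef_summable in hc.
  assert (Hder : forall m, is_C_derive_n (analytic_summand c) m
    (fun z => CSeries_from m
       (fun n => INR (fact n) / INR (fact (n - m)) * c n * Spoly (n - m) z)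
       + lambda_n c m)).
  { intros m. destruct m as [|m].
    - intros z. unfold CSeries_from. cbv beta.
      rewrite (is_Cseries_unique _ _ (is_Cseries_Spoly c hc 0 z)), analytic_summand_eq by easy.
      simpl lambda_n. ring.
    (* For positive order, [lambda_n] restores exactly the value at [1] subtracted in the series of
       [Spoly]. *)
    - eapply is_C_derive_n_ext; [|exact (is_C_derive_n_analytic_summand c hc m)].
      intros z. unfold CSeries_from. cbv beta.
      rewrite (is_Cseries_unique _ _ (is_Cseries_Spoly c hc (S m) z)).
      rewrite (lambda_n_eq c hc (S m)) by lia. ring. }
  assert (Hl : lambda_n c 1 = lambda c).
  { unfold lambda. rewrite (is_Cseries_unique _ _ (is_Cseries_lambda c hc)).
    apply lambda_n_eq; [exact hc|lia]. }
  assert (Hfact : forall k, INR (1 + k) = (INR (fact (1 + k)) / INR (fact (1 + k - 1)))%R).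
  { intros k. replace (1 + k - 1)%nat with k by lia. change (1 + k)%nat with (S k).
    rewrite fact_simpl, mult_INR. field. apply INR_fact_neq_0. }
  assert (H1 : forall z k, INR (1 + k) * c (1 + k)%nat * Spoly (1 + k - 1) z
    = INR (fact (1 + k)) / INR (fact (1 + k - 1)) * c (1 + k)%nat * Spoly (1 + k - 1) z).
  { intros z k. now rewrite Hfact, RtoC_div by apply INR_fact_neq_0. }
  split; [|split; [|split; [|split; [exact Hl|split; [|split; [|split]]]]]].
  - intros z. exact (ex_series_Spoly_abs c hc z).
  - split; [|split].
    + eexists. exact (is_Cseries_lambda c hc).
    + intros z. eexists. eapply is_Cseries_ext; [|exact (is_Cseries_Spoly c hc 1 z)].
      intros k. symmetry. apply H1.
    (* Order one differentiates some [h] that agrees pointwise with the summand, so the derivative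
       is transferred by extensionality. *)
    + intros z. destruct (Hder 1%nat) as (h & Hh & Hd).
      eapply is_C_derive_ext; [intros w; symmetry; apply Hh| |exact (Hd z)].
      rewrite Hl. f_equal. unfold CSeries_from, CSeries.
      f_equal; apply Series_ext; intros k; now rewrite <- H1.
  - intros m. split; [|split].
    + intros Hm. eexists. exact (is_Cseries_lambda_n c hc m Hm).
    + intros z. eexists. exact (is_Cseries_Spoly c hc m z).
    + exact (Hder m).
  - intros m Hm. split.
    + intros z. eexists. exact (is_Cseries_bernoulli c hc m (z + 1) Hm).
    + destruct m as [|m]; [lia|].
      eapply is_C_derive_n_ext; [|exact (is_C_derive_n_analytic_summand c hc m)].
      intros z. symmetry.
      exact (is_Cseries_unique _ _ (is_Cseries_bernoulli c hc (S m) (z + 1) Hm)).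
  - eexists. exact (is_Cseries_mu c hc).
  - intros z. eexists. exact (is_Cseries_primitive c hc z).
  - intros F. split.
    (* The constant is the difference at [0] between [F] and the primitive with [K = 0]. *)
    + intros HF. eexists. intros z.
      rewrite (is_C_derive_eq_const _ _ _ HF (is_C_derive_primitive c hc 0) z).
      rewrite Cplus_0_r. reflexivity.
    + intros [K HK] z.
      eapply is_C_derive_ext; [|reflexivity|exact (is_C_derive_primitive c hc K z)].
      intros w. symmetry. apply HK.
Qed.
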